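(* Let $(M,J)$ be an $n$-dimensional compact complex manifold endowed with a balanced metric $g$ with associated fundamental form $\omega$. Let $\{M_t\}_{t\in I}$ be a differentiable family of compact complex manifolds with $M_0=M$, parametrized by $\varphi(t)\in\mathcal{A}^{0,1}(T^{1,0}(M))$, for $t\in I:=(-\epsilon,\epsilon)$, $\epsilon>0$. Let $\{\omega_t\}_{t\in I}$ be a smooth family of Hermitian metrics along $\{M_t\}_{t\in I}$, written as $$\omega_t=e^{i_{\varphi(t)}|i_{\overline{\varphi(t)}}}(\omega(t)),$$ where, locally, $\omega(t)=\omega_{ij}(t)\,dz^i\wedge d\overline{z}^j\in\mathcal{A}^{1,1}(M)$ and $\omega_0=\omega$. Writing $\omega_t^{n-1}$ locally as $$e^{i_{\varphi(t)}|i_{\overline{\varphi(t)}}}\big(\omega_{i_1j_1}(t)\cdots\omega_{i_{n-1}j_{n-1}}(t)\,dz^{i_1}\wedge d\overline{z}^{j_1}\wedge\dots\wedge dz^{i_{n-1}}\wedge d\overline{z}^{j_{n-1}}\big),$$ set $$(\omega^{n-1}(t))':=\frac{\partial}{\partial t}\big(\omega_{i_1j_1}(t)\cdots\omega_{i_{n-1}j_{n-1}}(t)\big)\,dz^{i_1}\wedge d\overline{z}^{j_1}\wedge\dots\wedge dz^{i_{n-1}}\wedge d\overline{z}^{j_{n-1}}\in\mathcal{A}^{n-1,n-1}(M).$$ If every metric $\omega_t$, $t\in I$, is balanced, then $$\partial\big(i_{\varphi'(0)}(\omega^{n-1})\big)=-\overline{\partial}\,(\omega^{n-1}(0))',$$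 where $(\omega^{n-1}(0))'$ denotes $(\omega^{n-1}(t))'$ evaluated at $t=0$ and $\varphi'(0)=\frac{\partial\varphi}{\partial t}\big|_{t=0}$.
   Context: Balanced metrics: a Hermitian metric $g$ on an $n$-dimensional complex manifold with fundamental form $\omega(X,Y)=g(JX,Y)$ is balanced if $d\omega^{n-1}=0$. A Hermitian metric is identified with its fundamental form. $\mathcal{A}^{p,q}(M)$ is the space of smooth complex $(p,q)$-forms on $M$, and $d=\partial+\overline{\partial}$. Repeated indices are summed. Vector forms and contraction: $\mathcal{A}^{0,1}(T^{1,0}(M))$ is the space of smooth $(0,1)$-forms with values in $T^{1,0}M$, called $(0,1)$-vector forms. For $\varphi=\beta\otimes V$ with $\beta$ a $(0,1)$-form and $V$ a $(1,0)$-vector field, the contraction $i_\varphi:\mathcal{A}^{p,q}(M)\to\mathcal{A}^{p-1,q+1}(M)$ is $i_\varphi(\alpha)=\beta\wedge i_V(\alpha)$, where $i_V$ is the usual interior product, extended additively to all $(0,1)$-vector forms. Similarly $i_{\overline\varphi}(\alpha)=\overline\beta\wedge i_{\overline V}(\alpha)$ for the conjugate $\overline\varphi=\overline\beta\otimes\overline V$. Families: a differentiable family $\{M_t\}_{t\in I}$ of compact complex manifolds is given by a differentiable manifold $\mathcal{M}$ and a proper differentiable surjective map $\pi:\mathcal{M}\to I$ whose Jacobian has rank equal to $\dim I$ everywhere, with fibres $\pi^{-1}(t)=M_t$ as complex manifolds. As a differentiable manifold $\mathcal{M}\simeq M\times I$, so every $M_t$ is regarded as a complex structure on the differentiable manifold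 underlying $M=M_0$. The family is parametrized by $\varphi(t)$ if $\varphi(t)$ is a $(0,1)$-vector form on $M$ depending smoothly on $t$, with $\varphi(0)=0$ and $\overline{\partial}\varphi(t)=\frac12[\varphi(t),\varphi(t)]$, such that the local holomorphic functions on $M_t$ are exactly the smooth complex-valued functions $f$ on open sets of $M$ with $\overline{\partial}f-i_{\varphi(t)}(\partial f)=0$. Here $\epsilon$ is small enough that this parametrization and the isomorphism below hold for all $t\in I$. Extension map: with $e^{i_\varphi}=\sum_{k\ge0}\frac1{k!}i_\varphi^k$ and $e^{i_{\overline\varphi}}=\sum_{k\ge0}\frac1{k!}i_{\overline\varphi}^k$, for $\alpha\in\mathcal{A}^{p,q}(M)$ locally $\alpha=\alpha_{i_1\dots i_pj_1\dots j_q}dz^{i_1}\wedge\dots\wedge dz^{i_p}\wedge d\overline z^{j_1}\wedge\dots\wedge d\overline z^{j_q}$ (with $z^i$ local holomorphic coordinates on $M$), $$e^{i_\varphi|i_{\overline\varphi}}(\alpha):=\alpha_{i_1\dots i_pj_1\dots j_q}\,e^{i_\varphi}(dz^{i_1}\wedge\dots\wedge dz^{i_p})\wedge e^{i_{\overline\varphi}}(d\overline z^{j_1}\wedge\dots\wedge d\overline z^{j_q}).$$ For $t\in I$ this is a real linear isomorphism $\mathcal{A}^{p,q}(M)\to\mathcal{A}^{p,q}(M_t)$. A smooth family of Hermitian metrics along $\{M_t\}$ means that each $\omega_t$ is the fundamental form of a Hermitian metric on $M_t$ and $\omega_t$ depends smoothly on $t$. *)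

(* Defs.v *)
From HB Require Import structures.
From mathcomp Require Import all_boot all_order all_algebra.
From mathcomp.real_closed Require Export complex.
From mathcomp Require Import all_classical all_reals all_analysis.

Set Implicit Arguments.
Unset Strict Implicit.
Unset Printing Implicit Defensive.

Import Order.TTheory GRing.Theory Num.Theory.
Import numFieldNormedType.Exports.

Local Open Scope ring_scope.

(* An element of the exterior algebra of C^n (as a real space, complexified)
   is its family of coefficients in the basis [e_S], for
   [S : {set 'I_(n + n)}], where [e_S] is the product, in increasing order, of
   the covectors [e_s] for [s \in S]; here [e_(lshift n i) = dz^i] and
   [e_(rshift n i) = d\bar z^i].  Hence [e_S = dz^I /\ d\bar z^J] with
   increasing [I] and [J]. *)
Notation ext R n := {ffun {set 'I_(n + n)} -> R[i]}.

Section ExteriorAlgebra.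
Variables (R : realType) (n : nat).
Implicit Types (a b : ext R n) (S U : {set 'I_(n + n)}) (s : 'I_(n + n)).

Definition ebas S : ext R n := [ffun U => (U == S)%:R].

Definition ecov s : ext R n := ebas [set s]%SET.

(* The number of transpositions needed to sort the word S U. *)
Definition inversions S U : nat :=
  #|[set p in finset.setX S U | (p.2 < p.1)%N]%SET|.

Definition wedge a b : ext R n :=
  [ffun U : {set 'I_(n + n)} => \sum_(S : {set 'I_(n + n)} | S \subset U)
     (-1) ^+ inversions S (U :\: S)%SET * a S * b (U :\: S)%SET].

Definition wpow a (m : nat) : ext R n := iter m (wedge a) (ebas finset.set0).

(* Interior product with the vector of the dual basis [d/dz^i, d/d\bar z^i]
   of index s. *)
Definition interior s a : ext R n :=
  [ffun U : {set 'I_(n + n)} => if s \in U then 0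
     else (-1) ^+ #|[set u in U | (u < s)%N]%SET| * a (s |: U)%SET].

Definition swap s : 'I_(n + n) :=
  match fintype.split s with inl i => rshift n i | inr i => lshift n i end.

Definition econj a : ext R n :=
  \sum_(S : {set 'I_(n + n)})
     (conjc (a S)) *: \big[wedge/ebas finset.set0]_(s <- enum S) ecov (swap s).

Definition hol_part S : {set 'I_(n + n)} :=
  [set s in S | (s < n)%N]%SET.
Definition antihol_part S : {set 'I_(n + n)} :=
  [set s in S | (n <= s)%N]%SET.

Definition has_degree (k : nat) a : Prop :=
  forall S, a S != 0 -> #|S| = k.

Definition has_type (p q : nat) a : Prop :=
  forall S, a S != 0 -> #|hol_part S| = p /\ #|antihol_part S| = q.

(* The components of a vector form [\sum_i f i \otimes d/dz^i]. *)
Implicit Type f : 'I_n -> ext R n.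

Definition contr f a : ext R n :=
  \sum_(i < n) wedge (f i) (interior (lshift n i) a).

Definition contr_conj f a : ext R n :=
  \sum_(i < n) wedge (econj (f i)) (interior (rshift n i) a).

(* Each of the two contractions is nilpotent of order at most n.+1 when f has
   type (0,1), so that the exponential series is this finite sum. *)
Definition exp_op (F : ext R n -> ext R n) a : ext R n :=
  \sum_(k < n.+1) (k`!%:R)^-1 *: iter k F a.

Definition extmap f a : ext R n :=
  \sum_(S : {set 'I_(n + n)})
     a S *: wedge (exp_op (contr f) (ebas (hol_part S)))
                  (exp_op (contr_conj f) (ebas (antihol_part S))).

(* R^(2n) is C^n through z^i = x^i + i y^i, with x^i and y^i the coordinates of
   index lshift n i and rshift n i. *)
Definition zcoord s (y : 'rV[R]_(n + n)) : R[i] :=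
  match fintype.split s with
  | inl i => Complex (y 0 (lshift n i)) (y 0 (rshift n i))
  | inr i => Complex (y 0 (lshift n i)) (- y 0 (rshift n i))
  end.

Definition eval2 a (X Y : 'rV[R]_(n + n)) : R[i] :=
  \sum_(s < n + n) \sum_(u < n + n | (s < u)%N)
     a [set s; u]%SET *
     (zcoord s X * zcoord u Y - zcoord s Y * zcoord u X).

(* The complex structure J, multiplication by the imaginary unit on C^n. *)
Definition Jmul (X : 'rV[R]_(n + n)) : 'rV[R]_(n + n) :=
  row_mx (- rsubmx X) (lsubmx X).

End ExteriorAlgebra.

Arguments ebas {R n} S.
Arguments ecov {R n} s.

Local Open Scope classical_set_scope.

Section Smooth.
Variables (R : realType) (V W : normedModType R).

(* For open U.  All directional derivatives are used, which is the same as
   using the partial derivatives in a finite-dimensional V. *)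
Fixpoint Ck (k : nat) (U : set V) (f : V -> W) : Prop :=
  (forall x, U x -> {for x, continuous f}) /\
  match k with
  | 0%N => True
  | k'.+1 => forall v : V,
      (forall x, U x -> derivable f x v) /\ Ck k' U ('D_v f)
  end.

Definition smooth (U : set V) (f : V -> W) : Prop := forall k, Ck k U f.

End Smooth.

Definition csmooth (R : realType) (V : normedModType R) (U : set V)
    (f : V -> R[i]) : Prop :=
  smooth U (fun x => complex.Re (f x)) /\ smooth U (fun x => complex.Im (f x)).

Definition cderive (R : realType) (V : normedModType R) (f : V -> R[i])
    (v x : V) : R[i] :=
  Complex ('D_v (fun z => complex.Re (f z)) x)
          ('D_v (fun z => complex.Im (f z)) x).

Definition cderive1 (R : realType) (f : R -> R[i]) (t : R) : R[i] :=
  Complex ((fun s => complex.Re (f s))^`() t)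
          ((fun s => complex.Im (f s))^`() t).

Section LocalForms.
Variables (R : realType) (n : nat).
Local Notation E := 'rV[R]_(n + n).
Implicit Types (f : E -> R[i]) (al : E -> ext R n).

(* d/dz^i for s = lshift n i, d/d\bar z^i for s = rshift n i. *)
Definition wirtinger (s : 'I_(n + n)) f (y : E) : R[i] :=
  let dx i := cderive f (delta_mx 0 (lshift n i)) y in
  let dy i := cderive f (delta_mx 0 (rshift n i)) y in
  match fintype.split s with
  | inl i => 2^-1 * (dx i - 'i%C * dy i)
  | inr i => 2^-1 * (dx i + 'i%C * dy i)
  end.

Definition fwirtinger (s : 'I_(n + n)) al (y : E) : ext R n :=
  [ffun S => wirtinger s (fun z => al z S) y].

Definition del al (y : E) : ext R n :=
  \sum_(i < n) wedge (ecov (lshift n i)) (fwirtinger (lshift n i) al y).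

Definition delbar al (y : E) : ext R n :=
  \sum_(i < n) wedge (ecov (rshift n i)) (fwirtinger (rshift n i) al y).

Definition extd al (y : E) : ext R n := del al y + delbar al y.

Definition form0 f (y : E) : ext R n := f y *: ebas finset.set0.

Definition fsmooth (U : set E) al : Prop :=
  forall S, csmooth U (fun y => al y S).

(* [tau^* a] at the point y, for a in the exterior algebra at tau y. *)
Definition pull (tau : E -> E) (y : E) (a : ext R n) : ext R n :=
  \sum_(S : {set 'I_(n + n)}) a S *:
     \big[@wedge R n/ebas finset.set0]_(s <- enum S)
        extd (form0 (fun z => zcoord s (tau z))) y.

(* [f, g] = (f^i /\ d_i g^j + g^i /\ d_i f^j) \otimes d_j for (0,1)-vector forms
   f = f^j \otimes d_j and g = g^j \otimes d_j. *)
Definition vbracket (f g : 'I_n -> E -> ext R n) (j : 'I_n) (y : E) : ext R n :=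
  \sum_(i < n) (wedge (f i y) (fwirtinger (lshift n i) (g j) y)
              + wedge (g i y) (fwirtinger (lshift n i) (f j) y)).

End LocalForms.

(* cmap and cinv are meaningful on cdom and on its image only. *)
Record chart (T V : Type) : Type := Chart {
  cdom : set T;
  cmap : T -> V;
  cinv : V -> T }.

Definition cimg (T V : Type) (c : chart T V) : set V := cmap c @` cdom c.

Section Manifolds.
Variables (R : realType) (T : topologicalType) (V : normedModType R).
Implicit Types (c : chart T V) (A : set (chart T V)).

Record is_chart c : Prop := IsChart {
  chart_open_dom : open (cdom c);
  chart_open_img : open (cimg c);
  chart_cancel : forall x, cdom c x -> cinv c (cmap c x) = x;
  chart_cont_map : forall x, cdom c x -> {for x, continuous (cmap c)};
  chart_cont_inv : forall y, cimg c y -> {for y, continuous (cinv c)} }.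

Definition overlap c c' : set V := cmap c @` (cdom c `&` cdom c').

Definition transition c c' : V -> V := fun y => cmap c' (cinv c y).

Definition covers A : Prop := forall x, exists2 c, A c & cdom c x.

Definition smooth_atlas A : Prop :=
  [/\ forall c, A c -> is_chart c,
      covers A &
      forall c c', A c -> A c' -> smooth (overlap c c') (transition c c')].

Definition smooth_manifold A : Prop :=
  [/\ hausdorff_space T, @second_countable T & smooth_atlas A].

(* The maximal smooth atlas containing A. *)
Definition smooth_charts A : set (chart T V) :=
  [set c | is_chart c /\ forall c', A c' ->
     smooth (overlap c c') (transition c c') /\
     smooth (overlap c' c) (transition c' c)].

End Manifolds.

Definition smooth_map (R : realType) (T T' : Type)
    (V V' : normedModType R) (A : set (chart T V)) (A' : set (chart T' V'))
    (f : T -> T') : Prop :=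
  forall c c', A c -> A' c' ->
    let D := [set y | cimg c y /\ cdom c' (f (cinv c y))] in
    open D /\ smooth D (fun y => cmap c' (f (cinv c y))).

Section ComplexManifolds.
Variables (R : realType) (n : nat) (T : topologicalType).
Local Notation E := 'rV[R]_(n + n).
Local Notation echart := (chart T E).
Implicit Types (c : echart) (A B : set echart).

Definition complex_atlas A : Prop :=
  smooth_atlas A /\
  forall c c', A c -> A c' -> forall y, overlap c c' y ->
    forall i j : 'I_n,
      wirtinger (rshift n j)
        (fun z => zcoord (lshift n i) (transition c c' z)) y = 0.

Definition complex_manifold A : Prop :=
  [/\ hausdorff_space T, @second_countable T & complex_atlas A].

Definition smooth_fun_on A (W : set T) (f : T -> R[i]) : Prop :=
  forall c, A c ->
    csmooth (cmap c @` (cdom c `&` W)) (fun y => f (cinv c y)).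

Definition holomorphic_on A (W : set T) (f : T -> R[i]) : Prop :=
  smooth_fun_on A W f /\
  forall c, A c -> forall y, (cmap c @` (cdom c `&` W)) y ->
    forall j : 'I_n, wirtinger (rshift n j) (fun z => f (cinv c z)) y = 0.

(* A form is given by its expressions in the charts of the maximal smooth
   atlas; only the values on the image of each chart are meaningful. *)
Definition diff_form : Type := echart -> E -> ext R n.

Definition smooth_form A (al : diff_form) : Prop :=
  (forall c, smooth_charts A c -> fsmooth (cimg c) (al c)) /\
  forall c c', smooth_charts A c -> smooth_charts A c' ->
    forall y, overlap c c' y ->
      al c y = pull (transition c c') y (al c' (transition c c' y)).

Definition form_eq A (al be : diff_form) : Prop :=
  forall c, smooth_charts A c -> forall y, cimg c y -> al c y = be c y.

(* A^{p,q} of the complex manifold with atlas B, whose underlying smooth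
   manifold is the one defined by A. *)
Definition form_of_type A B (p q : nat) (al : diff_form) : Prop :=
  smooth_form A al /\
  forall c, B c -> forall y, cimg c y -> has_type p q (al c y).

Definition metric_tensor : Type := echart -> E -> 'M[R]_(n + n).

Definition mxform (G : 'M[R]_(n + n)) (X Y : E) : R := (X *m G *m Y^T) 0 0.

Definition riemannian_metric A (g : metric_tensor) : Prop :=
  [/\ forall c, smooth_charts A c -> forall i j,
        smooth (cimg c) (fun y => g c y i j),
      forall c, smooth_charts A c -> forall y, cimg c y ->
        (forall X Y, mxform (g c y) X Y = mxform (g c y) Y X) /\
        (forall X, X != 0 -> 0 < mxform (g c y) X X) &
      forall c c', smooth_charts A c -> smooth_charts A c' ->
        forall y, overlap c c' y -> forall X Y,
          mxform (g c y) X Y =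
          mxform (g c' (transition c c' y))
            ('D_X (transition c c') y) ('D_Y (transition c c') y)].

Definition hermitian_metric A B (g : metric_tensor) : Prop :=
  riemannian_metric A g /\
  forall c, B c -> forall y, cimg c y -> forall X Y,
    mxform (g c y) (Jmul X) (Jmul Y) = mxform (g c y) X Y.

Definition fundamental_form A B (g : metric_tensor) (om : diff_form) :
    Prop :=
  [/\ smooth_form A om,
      forall c, smooth_charts A c -> forall y, cimg c y ->
        has_degree 2 (om c y) &
      forall c, B c -> forall y, cimg c y -> forall X Y,
        eval2 (om c y) X Y = (mxform (g c y) (Jmul X) Y)%:C%C].

Definition balanced A (om : diff_form) : Prop :=
  forall c, smooth_charts A c -> forall y, cimg c y ->
    extd (fun z => wpow (om c z) n.-1) y = 0.

(* The components f c i of [\sum_i f c i \otimes d/dz^i] in the charts c of the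
   complex atlas. *)
Definition vform : Type := echart -> 'I_n -> E -> ext R n.

Definition vform01 A (f : vform) : Prop :=
  [/\ forall c, A c -> forall i, fsmooth (cimg c) (f c i),
      forall c, A c -> forall i y, cimg c y -> has_type 0 1 (f c i y) &
      forall c c', A c -> A c' -> forall y, overlap c c' y -> forall i,
        pull (transition c c') y (f c' i (transition c c' y)) =
        \sum_(k < n)
          wirtinger (lshift n k)
            (fun z => zcoord (lshift n i) (transition c c' z)) y
          *: f c k y].

(* be is the image of al under the extension map of f; this needs the charts of
   the complex atlas A only, in which f and the extension map are defined. *)
Definition is_extension A (f : vform) (al be : diff_form) : Prop :=
  forall c, A c -> forall y, cimg c y ->
    be c y = extmap (fun i => f c i y) (al c y).

Definition extension_isomorphism A B (f : vform) (p q : nat) : Prop :=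
  [/\ forall al, form_of_type A A p q al ->
        exists2 be, form_of_type A B p q be & is_extension A f al be,
      forall be, form_of_type A B p q be ->
        exists2 al, form_of_type A A p q al & is_extension A f al be &
      forall al al' be, form_of_type A A p q al -> form_of_type A A p q al' ->
        is_extension A f al be -> is_extension A f al' be -> form_eq A al al'].

End ComplexManifolds.

Definition time_interval (R : realType) (eps : R) : set R :=
  [set t | - eps < t < eps].

Definition time_chart (R : realType) (eps : R) : chart R R :=
  Chart (time_interval eps) id id.

Definition prod_chart (R : realType) (eps : R) (T V : Type) (c : chart T V) :
    chart (T * R) (V * R) :=
  Chart (cdom c `*` time_interval eps)
        (fun p => (cmap c p.1, p.2)) (fun q => (cinv c q.1, q.2)).

Section Families.
Variables (R : realType) (n : nat) (T : topologicalType) (eps : R).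
Local Notation E := 'rV[R]_(n + n).
Local Notation I := (time_interval eps).
Variable A : set (chart T E).

Definition prod_atlas : set (chart (T * R) (E * R)) :=
  [set prod_chart eps c | c in A].

(* The total space is N, with projection proj; triv (with inverse
   p |-> (ret p, proj p)) is the diffeomorphism over I between M x I and N
   through which the fibre over t is regarded as a complex structure, with
   atlas Mt t, on the smooth manifold underlying M. *)
Record differentiable_family (N : topologicalType)
    (AN : set (chart N 'rV[R]_(n + n).+1)) (proj : N -> R)
    (triv : T * R -> N) (ret : N -> T) (Mt : R -> set (chart T E)) : Prop :=
  DifferentiableFamily {
  fam_manifold : smooth_manifold AN;
  fam_proj_smooth : smooth_map AN [set time_chart eps] proj;
  fam_proj_surj : range proj = I;
  fam_proj_proper : forall K : set R, K `<=` I -> compact K ->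
    compact (proj @^-1` K);
  fam_proj_rank : forall c, AN c -> forall y, cimg c y ->
    exists v, 'D_v (fun z => proj (cinv c z)) y != 0;
  fam_triv_smooth : smooth_map prod_atlas AN triv;
  fam_triv_inv_smooth : smooth_map AN prod_atlas (fun p => (ret p, proj p));
  fam_triv_proj : forall x t, I t -> proj (triv (x, t)) = t;
  fam_triv_cancel : forall x t, I t -> ret (triv (x, t)) = x;
  fam_ret_cancel : forall p, triv (ret p, proj p) = p;
  fam_fibre_complex : forall t, I t -> complex_atlas (Mt t);
  fam_fibre_smooth : forall t, I t -> Mt t `<=` smooth_charts A;
  fam_fibre0 : Mt 0 = A }.

Record parametrizes (Mt : R -> set (chart T E)) (phi : R -> vform R n T) :
    Prop := Parametrizes {
  par_vform : forall t, I t -> vform01 A (phi t);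
  par_smooth : forall c, A c -> forall i S,
    csmooth (cimg c `*` I : set (E * R)) (fun p => phi p.2 c i p.1 S);
  par_0 : forall c, A c -> forall i y, cimg c y -> phi 0 c i y = 0;
  par_integrable : forall t, I t -> forall c, A c -> forall y, cimg c y ->
    forall j, delbar (phi t c j) y =
              2^-1 *: vbracket (phi t c) (phi t c) j y;
  par_holomorphic : forall t, I t -> forall (W : set T), open W ->
    forall f : T -> R[i],
    holomorphic_on (Mt t) W f <->
    smooth_fun_on A W f /\
    forall c, A c -> forall y, (cmap c @` (cdom c `&` W)) y ->
      let fc := form0 (fun z => f (cinv c z)) in
      delbar fc y - contr (fun i => phi t c i y) (del fc y) = 0 }.

Record smooth_hermitian_family (Mt : R -> set (chart T E))
    (omt : R -> diff_form R n T) : Prop := SmoothHermitianFamily {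
  herm_fibre : forall t, I t -> exists2 g,
    hermitian_metric A (Mt t) g & fundamental_form A (Mt t) g (omt t);
  herm_smooth : forall c, smooth_charts A c -> forall S,
    csmooth (cimg c `*` I : set (E * R)) (fun p => omt p.2 c p.1 S) }.

End Families.

Section TimeDerivatives.
Variables (R : realType) (n : nat) (T : topologicalType).

Definition vform_deriv (phi : R -> vform R n T) (t : R) : vform R n T :=
  fun c i y => [ffun S => cderive1 (fun s => phi s c i y S) t].

Definition coef11 (a : ext R n) (i j : 'I_n) : R[i] :=
  a [set lshift n i; rshift n j]%SET.

(* The derivative at t of the m-th power of w s, computed on the coefficients
   of the products of the [dz^i /\ d\bar z^j]. *)
Definition pow_deriv (m : nat) (w : R -> diff_form R n T) (t : R) :
    diff_form R n T :=
  fun c y =>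
    \sum_(i : {ffun 'I_m -> 'I_n}) \sum_(j : {ffun 'I_m -> 'I_n})
      cderive1 (fun s => \prod_(k < m) coef11 (w s c y) (i k) (j k)) t *:
      \big[@wedge R n/ebas finset.set0]_(k < m)
         wedge (ecov (lshift n (i k))) (ecov (rshift n (j k))).

End TimeDerivatives.

(* Main.v *)
Require Import Defs.
From HB Require Import structures.
From mathcomp Require Import all_boot all_order all_algebra.
From mathcomp Require Import all_classical all_reals all_analysis.
From mathcomp Require Import ring.

Set Implicit Arguments.
Unset Strict Implicit.
Unset Printing Implicit Defensive.

Import Order.TTheory GRing.Theory Num.Theory.
Import numFieldNormedType.Exports.

Local Open Scope classical_set_scope.
Local Open Scope ring_scope.

(* In a chart, write w(t) for the (1,1)-form with extension omega_t.  Since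
   phi(0) = 0, the extension map is the identity at t = 0, and its derivative
   there is i_phi' + i_(conj phi') (each exponential contributes its linear
   term only).  Contractions being derivations of the wedge product, the
   derivative at 0 of omega_t^m, for m = n - 1, is
     (omega^m(0))' + i_phi'(omega^m) + q,
   where the three terms have m, m + 1 and m - 1 antiholomorphic covectors.
   The left hand side is closed, by commuting d with d/dt (Schwarz), and the
   part of its differential with m + 1 antiholomorphic covectors is
     delbar (omega^m(0))' + del (i_phi'(omega^m)).
   As only omega_t is assumed to depend smoothly on t, the t-derivative of w is
   obtained by Cramer's rule: extension is given by a matrix which depends
   smoothly on t and is the identity at 0. *)

(** * The exterior algebra: creation and annihilation operators *)

(** Balancedness of omega_t is tested in every smooth chart of the underlying manifold, so one
    holomorphic chart of M serves for all t: d is a fixed operator there and only the coefficients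
    move with t. Derivatives are total functions, hence [pow_deriv] is tied to omega_t only once the
    coefficients of w(t) are known to be differentiable in t; this is what makes Cramer's rule
    necessary. Joint smoothness in space and time is used for omega_t^m alone: the three terms of
    its derivative are never differentiated in space as a sum. Counting antiholomorphic covectors
    replaces this, because near a point each coefficient of the sum comes from at most one of the
    terms, and functions that agree locally have the same derivatives. Signs are settled once, for
    left multiplication by a single covector and its commutation with interior products; an
    induction over such multiplications carries the identities to all forms. *)

Section ExteriorAlgebraTheory.
Variables (R : realType) (n : nat).
Implicit Types (a b : ext R n) (S U W : {set 'I_(n + n)}) (s u : 'I_(n + n)).

Lemma ext_scaleE (k : R[i]) a U : (k *: a) U = k * a U.
Proof. by rewrite ffunE. Qed.

Lemma ext_oppE a U : (- a) U = - a U.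
Proof. by rewrite ffunE. Qed.

Lemma ext_addE a b U : (a + b) U = a U + b U.
Proof. by rewrite ffunE. Qed.

Lemma ext_sumE (I : Type) (r : seq I) (P : pred I) (F : I -> ext R n) U :
  (\sum_(i <- r | P i) F i) U = \sum_(i <- r | P i) F i U.
Proof. by rewrite sum_ffunE. Qed.

Lemma ext_basis a : a = \sum_S a S *: ebas S.
Proof.
apply/ffunP => U; rewrite ext_sumE (bigD1 U) //= big1 ?addr0.
  by rewrite ext_scaleE ffunE eqxx mulr1.
by move=> S neSU; rewrite ext_scaleE ffunE eq_sym (negbTE neSU) mulr0.
Qed.

Lemma wedgeDl a a' b : wedge (a + a') b = wedge a b + wedge a' b.
Proof.
apply/ffunP => U; rewrite !ffunE -big_split /=; apply: eq_bigr => S _.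
by rewrite ffunE mulrDr mulrDl.
Qed.

Lemma wedgeDr a b b' : wedge a (b + b') = wedge a b + wedge a b'.
Proof.
apply/ffunP => U; rewrite !ffunE -big_split /=; apply: eq_bigr => S _.
by rewrite ffunE mulrDr.
Qed.

Lemma wedgeZl (k : R[i]) a b : wedge (k *: a) b = k *: wedge a b.
Proof.
apply/ffunP => U; rewrite ext_scaleE !ffunE mulr_sumr; apply: eq_bigr => S _.
by rewrite ext_scaleE !mulrA [k * _]mulrC.
Qed.

Lemma wedgeZr (k : R[i]) a b : wedge a (k *: b) = k *: wedge a b.
Proof.
apply/ffunP => U; rewrite ext_scaleE !ffunE mulr_sumr; apply: eq_bigr => S _.
by rewrite ext_scaleE mulrCA.
Qed.

Lemma wedge0l b : wedge 0 b = 0.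
Proof. by have := wedgeZl 0 0 b; rewrite !scale0r. Qed.

Lemma wedge0r a : wedge a 0 = 0.
Proof. by have := wedgeZr 0 a 0; rewrite !scale0r. Qed.

Lemma wedge_suml (I : Type) (r : seq I) (P : pred I) (F : I -> ext R n) b :
  wedge (\sum_(i <- r | P i) F i) b = \sum_(i <- r | P i) wedge (F i) b.
Proof.
elim/big_rec2: _ => [|i x y _ <-]; first exact: wedge0l.
exact: wedgeDl.
Qed.

Lemma wedge_sumr (I : Type) (r : seq I) (P : pred I) a (F : I -> ext R n) :
  wedge a (\sum_(i <- r | P i) F i) = \sum_(i <- r | P i) wedge a (F i).
Proof.
elim/big_rec2: _ => [|i x y _ <-]; first exact: wedge0r.
exact: wedgeDr.
Qed.

Lemma interior_add s a b :
  Defs.interior s (a + b) = Defs.interior s a + Defs.interior s b.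
Proof.
apply/ffunP => U; rewrite !ffunE; case: ifP => _; first by rewrite addr0.
by rewrite mulrDr.
Qed.

Lemma interior_scale s (k : R[i]) a :
  Defs.interior s (k *: a) = k *: Defs.interior s a.
Proof.
apply/ffunP => U; rewrite ext_scaleE !ffunE; case: ifP => _.
  by rewrite mulr0.
by rewrite mulrCA.
Qed.

Lemma interior_zero s : Defs.interior s 0 = 0 :> ext R n.
Proof. by have := interior_scale s 0 0; rewrite !scale0r. Qed.

Lemma inversionsE S U :
  inversions S U = (\sum_(s in S) #|[set u in U | (u < s)%N]|)%N.
Proof.
rewrite /inversions -sum1dep_card.
under [RHS]eq_bigr do rewrite -sum1dep_card.
rewrite pair_big_dep /=; apply: eq_bigl => -[s u] /=.
by rewrite finset.in_setX /= andbA.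
Qed.

Lemma cnt_setD1 U u s :
  #|[set w in U | (w < s)%N]%SET| =
  ((u \in U) && (u < s) + #|[set w in U :\ u | (w < s)%N]%SET|)%N.
Proof.
rewrite (cardsD1 u) !inE; congr (_ + _)%N.
by apply: eq_card => w; rewrite !inE andbA.
Qed.

Lemma cnt_setU1 U u s : u \notin U ->
  #|[set w in (u |: U)%SET | (w < s)%N]%SET| =
  ((u < s) + #|[set w in U | (w < s)%N]%SET|)%N.
Proof.
move=> uU.
by rewrite (cnt_setD1 (u |: U)%SET u) finset.setU11 finset.setU1K.
Qed.

(** Creation operator: among all splittings of U, only the one with first part {s} survives. *)
Lemma wedge_ecovE s b U :
  wedge (ecov s) b U =
  if s \in U then (-1) ^+ #|[set u in U | (u < s)%N]| * b (U :\ s) else 0.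
Proof.
rewrite ffunE; case: ifPn => sU; last first.
  rewrite big1 // => S SU; rewrite ffunE.
  case: eqP => [eS|_]; last by rewrite mulr0 mul0r.
  by move: SU; rewrite eS finset.sub1set (negbTE sU).
rewrite (bigD1 [set s]%SET) ?finset.sub1set //= big1 ?addr0; last first.
  by move=> S /andP[_ neS]; rewrite ffunE (negbTE neS) mulr0 mul0r.
rewrite ffunE eqxx mulr1 inversionsE big_set1; congr (_ ^+ _ * _).
apply: eq_card => u; rewrite !inE; case: eqP => [->|] //=.
by rewrite ltnn andbF.
Qed.

Lemma wedge_1l b : wedge (ebas finset.set0) b = b.
Proof.
apply/ffunP => U; rewrite ffunE (bigD1 finset.set0) ?finset.sub0set //=.
rewrite big1 ?addr0; last first.
  by move=> S /andP[_ neS]; rewrite ffunE (negbTE neS) mulr0 mul0r.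
by rewrite ffunE eqxx inversionsE finset.big_set0 finset.setD0 expr0 !mul1r.
Qed.

(** The case of associativity on which the rest is built: with a covector in front, the signs reduce
    to counting the elements below [s]. *)
Lemma wedge_ecovA s a b :
  wedge (wedge (ecov s) a) b = wedge (ecov s) (wedge a b).
Proof.
apply/ffunP => U; rewrite wedge_ecovE ffunE.
under eq_bigr do rewrite wedge_ecovE.
rewrite (bigID (fun S => s \in S)) /= addrC big1 ?add0r; last first.
  by move=> S /andP[_ /negbTE->]; rewrite mulr0 mul0r.
case: ifPn => sU; last first.
  rewrite big1 // => S /andP[/fintype.subsetP SU sS].
  by rewrite SU in sU.
rewrite ffunE mulr_sumr.
(* Subsets of U containing [s] correspond to subsets of U without [s]. *)
rewrite (reindex_onto (fun S => s |: S) (fun S => S :\ s)); last first.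
  by move=> S /andP[_ sS]; rewrite finset.setD1K.
have inE1 S : (s \notin S) -> ((s |: S) :\ s)%SET = S by apply: finset.setU1K.
apply: eq_big => [S|S /andP[/andP[SU _] /eqP eS]].
  rewrite finset.subsetD1 finset.subUset finset.sub1set sU !inE eqxx /= andbT.
  congr (_ && _); apply/eqP/idP => [<-|/inE1//].
  by rewrite !inE eqxx.
have sS : s \notin S by rewrite -eS !inE eqxx.
rewrite finset.setU11 eS -finset.setDDl.
set W := (U :\ s :\: S)%SET.
(* The elements of U below [s] lie either in S or in W, which splits the sign. *)
have -> : #|[set u in U | (u < s)%N]%SET| =
    (#|[set u in S | (u < s)%N]%SET| + #|[set u in W | (u < s)%N]%SET|)%N.
  rewrite -(cardsID S); congr (_ + _)%N; apply: eq_card => u; rewrite !inE.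
    rewrite andbC andbA; congr (_ && _); apply/andP/idP => [[]//|uS].
    by split=> //; move/fintype.subsetP: SU; apply; rewrite inE uS orbT.
  case: (u \in S) => //=; case: eqP => [->|_] //=.
  by rewrite ltnn andbF.
have -> : #|[set u in (s |: S)%SET | (u < s)%N]%SET| =
  #|[set u in S | (u < s)%N]%SET|.
  apply: eq_card => u; rewrite !inE; case: eqP => [->|_] //=.
  by rewrite ltnn andbF.
rewrite !inversionsE big_setU1 //= !exprD; ring.
Qed.

(** Both orders remove the same two indices; the count below the larger one drops by one exactly
    when the smaller one is removed first. *)
Lemma ecov_anticomm s u a :
  wedge (ecov s) (wedge (ecov u) a) = - wedge (ecov u) (wedge (ecov s) a).
Proof.
apply/ffunP => U; rewrite [RHS]ffunE !wedge_ecovE.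
rewrite !inE; have [->|neus] := eqVneq u s.
  by case: ifP => _; rewrite ?mulr0 ?oppr0.
case sU: (s \in U); case uU: (u \in U); rewrite ?andbF ?mulr0 ?oppr0 //=.
rewrite (cnt_setD1 U u s) (cnt_setD1 U s u) sU uU !exprD.
rewrite finset.setDDl finset.setUC -finset.setDDl.
by case: (ltngtP s u) => [_|_|/val_inj e]; rewrite ?e ?eqxx // in neus *;
  rewrite /= ?expr0 ?expr1; ring.
Qed.

(** The canonical anticommutation relation of annihilation and creation operators, from which
    contractions become derivations. *)
Lemma interior_ecov s u a :
  Defs.interior s (wedge (ecov u) a) =
  (u == s)%:R *: a - wedge (ecov u) (Defs.interior s a).
Proof.
apply/ffunP => U; rewrite ffunE wedge_ecovE [RHS]ffunE.
rewrite [X in _ + X]ffunE wedge_ecovE ext_scaleE !ffunE.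
rewrite !inE; have [->|neus] := eqVneq u s; rewrite /= ?mul1r ?mul0r.
  case sU: (s \in U).
    rewrite (cnt_setD1 U s s) sU ltnn finset.setD1K // mulrA -exprMn mulrNN.
    by rewrite mul1r expr1n mul1r subrr.
  rewrite finset.setU1K ?sU // subr0 cnt_setU1 ?sU // ltnn mulrA -exprMn.
  by rewrite mulrNN mul1r expr1n mul1r.
case sU: (s \in U); case uU: (u \in U); rewrite ?mulr0 ?subr0 // sub0r.
rewrite (cnt_setD1 U u s) cnt_setU1 ?sU // uU !exprD.
have -> : ((s |: U) :\ u = s |: U :\ u)%SET.
  apply/setP => x; rewrite !inE; case: (eqVneq x s) => [->|];
    rewrite ?andbT //=.
  by rewrite eq_sym neus.
by case: (ltngtP s u) => [_|_|/val_inj e]; rewrite ?e ?eqxx // in neus *;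
  rewrite /= ?expr0 ?expr1; ring.
Qed.

(** The algebra is generated from 1 by linear combinations and left multiplication by covectors. *)
Lemma ext_ind (P : ext R n -> Prop) :
  P (ebas finset.set0) -> (forall a b, P a -> P b -> P (a + b)) ->
  (forall k a, P a -> P (k *: a)) ->
  (forall s a, P a -> P (wedge (ecov s) a)) ->
  forall a, P a.
Proof.
move=> P1 PD PZ Pe a; rewrite (ext_basis a).
apply: (big_ind P) => // [|S _];
  first by rewrite -(scale0r (ebas finset.set0)); apply: PZ.
apply: PZ; have [m] := ubnP #|S|; elim: m S => // m IHm S leSm.
have [->//|/finset.set0Pn[s0 s0S]] := eqVneq S finset.set0.
(* Peeling off the least index produces no sign. *)
case: (@arg_minnP _ s0 (fun s => s \in S) val s0S) => s sS smin.
have -> : ebas S = wedge (ecov s) (ebas (S :\ s)%SET) :> ext R n.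
  apply/ffunP => U; rewrite wedge_ecovE !ffunE.
  case: ifPn => sU; last by case: eqP => // eU; rewrite eU sS in sU.
  have -> : (U :\ s == S :\ s)%SET = (U == S).
    apply/eqP/eqP => [e|->//].
    by rewrite -(finset.setD1K sU) e finset.setD1K.
  case: eqP => [->|_]; last by rewrite mulr0.
  rewrite mulr1 (eq_card0 (A := [set u in S | _]%SET)) ?expr0 // => u.
  rewrite !inE; case uS: (u \in S) => //=.
  by apply/negbTE; rewrite -leqNgt; apply: smin.
apply: Pe; apply: IHm; rewrite -ltnS (leq_trans _ leSm) // ltnS.
by rewrite [leqRHS](cardsD1 s) sS.
Qed.

Lemma wedge_1r a : wedge a (ebas finset.set0) = a.
Proof.
elim/ext_ind: a => [|a b IHa IHb|k a IH|s a IH]; first exact: wedge_1l.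
- by rewrite wedgeDl IHa IHb.
- by rewrite wedgeZl IH.
by rewrite wedge_ecovA IH.
Qed.

End ExteriorAlgebraTheory.

(** * Contractions and the antiholomorphic degree *)

Section ContractionTheory.
Variables (R : realType) (n : nat).
Implicit Types (a b : ext R n) (S U W : {set 'I_(n + n)}) (s u : 'I_(n + n)).
Implicit Types (f : 'I_n -> ext R n).

Lemma degree1E a : has_degree 1 a -> a = \sum_s a [set s]%SET *: ecov s.
Proof.
move=> a1; apply/ffunP => U; rewrite ext_sumE.
have [aU0|/a1/eqP/cards1P[s ->]] := eqVneq (a U) 0.
  rewrite big1 // => s _; rewrite ext_scaleE ffunE.
  by case: eqP => [<-|_]; rewrite ?aU0 ?mulr0 ?mul0r.
rewrite (bigD1 s) //= big1 ?addr0 => [|u neus]; rewrite ext_scaleE ffunE.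
  by rewrite eqxx mulr1.
by rewrite (inj_eq finset.set1_inj) eq_sym (negbTE neus) mulr0.
Qed.

Lemma wedge_degree1A c a b : has_degree 1 c ->
  wedge (wedge c a) b = wedge c (wedge a b).
Proof.
move=> /degree1E->; rewrite !wedge_suml; apply: eq_bigr => s _.
by rewrite !wedgeZl wedge_ecovA.
Qed.

Lemma wedge_degree1_ecov c s a : has_degree 1 c ->
  wedge c (wedge (ecov s) a) = - wedge (ecov s) (wedge c a).
Proof.
move=> /degree1E->; rewrite !wedge_suml wedge_sumr -sumrN.
apply: eq_bigr => u _; rewrite !wedgeZl wedgeZr ecov_anticomm.
by rewrite scalerN.
Qed.

Lemma contrD f a b : contr f (a + b) = contr f a + contr f b.
Proof.
by rewrite -big_split /=; apply: eq_bigr => i _; rewrite interior_add wedgeDr.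
Qed.

Lemma contrZ f (k : R[i]) a : contr f (k *: a) = k *: contr f a.
Proof.
by rewrite scaler_sumr; apply: eq_bigr => i _; rewrite interior_scale wedgeZr.
Qed.

Lemma contr0 f : contr f 0 = 0.
Proof. by rewrite /contr big1 // => i _; rewrite interior_zero wedge0r. Qed.

Lemma contr_sum (I : Type) (r : seq I) (P : pred I) f (F : I -> ext R n) :
  contr f (\sum_(i <- r | P i) F i) = \sum_(i <- r | P i) contr f (F i).
Proof.
elim/big_rec2: _ => [|i x y _ <-]; first exact: contr0.
exact: contrD.
Qed.

Lemma interior_ebas0 s U : s \notin U ->
  Defs.interior s (ebas U) = 0 :> ext R n.
Proof.
move=> sU; apply/ffunP => W; rewrite !ffunE; case: ifP => // _.
by case: eqP => [e|_]; rewrite ?mulr0 // -e finset.setU11 in sU *.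
Qed.

Lemma wedgeNr a b : wedge a (- b) = - wedge a b.
Proof. by rewrite -scaleN1r wedgeZr scaleN1r. Qed.

(** The sign of the antiderivation [interior] cancels the one from moving the 1-form [f i] past
    [ecov s]. *)
Lemma contr_ecov f s a : (forall i, has_degree 1 (f i)) ->
  contr f (wedge (ecov s) a) =
  wedge (\sum_(i < n) (s == lshift n i)%:R *: f i) a +
  wedge (ecov s) (contr f a).
Proof.
move=> f1; rewrite wedge_suml wedge_sumr -big_split; apply: eq_bigr => i _ /=.
rewrite interior_ecov wedgeDr wedgeZr wedgeZl wedgeNr; congr (_ + _).
by rewrite wedge_degree1_ecov // opprK.
Qed.

Lemma contr_wedge f a b : (forall i, has_degree 1 (f i)) ->
  contr f (wedge a b) = wedge (contr f a) b + wedge a (contr f b).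
Proof.
move=> f1; elim/ext_ind: a => [|a a' IHa IHa'|k a IHa|s a IHa].
- rewrite !wedge_1l [contr f (ebas _)]big1 ?wedge0l ?add0r // => i _.
  by rewrite interior_ebas0 ?inE // wedge0r.
- by rewrite !(wedgeDl, contrD) IHa IHa' addrACA.
- by rewrite !(wedgeZl, contrZ) IHa scalerDr.
rewrite wedge_ecovA !contr_ecov // wedgeDl IHa wedgeDr addrA; congr (_ + _ + _).
- rewrite !wedge_suml; apply: eq_bigr => i _.
  by rewrite !wedgeZl wedge_degree1A.
- by rewrite wedge_ecovA.
by rewrite wedge_ecovA.
Qed.

(* The shift d expresses the degree q - d without truncated subtraction. *)
Definition antidegree (d q : nat) a : Prop :=
  forall S, a S != 0 -> (#|antihol_part S| + d = q)%N.

Lemma antidegree0 d q : antidegree d q 0.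
Proof. by move=> S; rewrite ffunE eqxx. Qed.

Lemma antidegreeD d q a b :
  antidegree d q a -> antidegree d q b -> antidegree d q (a + b).
Proof.
move=> ad bd S; rewrite ffunE; have [a0|/ad//] := eqVneq (a S) 0.
by rewrite a0 add0r => /bd.
Qed.

Lemma antidegreeZ d q (k : R[i]) a :
  antidegree d q a -> antidegree d q (k *: a).
Proof.
by move=> ad S; rewrite ext_scaleE mulf_eq0 negb_or => /andP[_ /ad].
Qed.

Lemma antidegree_sum d q (I : Type) (r : seq I) (P : pred I)
    (F : I -> ext R n) :
  (forall i, P i -> antidegree d q (F i)) ->
  antidegree d q (\sum_(i <- r | P i) F i).
Proof.
move=> Fd; apply: big_ind => //; first exact: antidegree0.
exact: antidegreeD.
Qed.

Lemma antidegree_ebas S : antidegree 0 #|antihol_part S| (ebas S).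
Proof.
by move=> U; rewrite ffunE addn0; case: (U =P S) => [->|_]; rewrite ?eqxx.
Qed.

Lemma antidegree_wedge d q d' q' a b :
  antidegree d q a -> antidegree d' q' b ->
  antidegree (d + d') (q + q') (wedge a b).
Proof.
move=> ad bd U; rewrite ffunE => nz.
have /existsP[S /and3P[SU aS bS]] :
    [exists S : {set 'I_(n + n)},
      [&& S \subset U, a S != 0 & b (U :\: S)%SET != 0]].
  apply: contraNT nz; rewrite negb_exists => /forallP nS.
  rewrite big1 // => S SU; move: (nS S); rewrite SU /= negb_and !negbK.
  by case/orP => /eqP->; rewrite ?(mulr0, mul0r).
rewrite -(ad _ aS) -(bd _ bS) addnACA; congr (_ + _)%N.
rewrite -(cardsID S); congr (_ + _)%N; apply: eq_card => s; rewrite !inE.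
  rewrite andbC andbA; congr (_ && _); apply/andP/idP => [[]//|sS].
  by split=> //; move/fintype.subsetP: SU; apply.
by rewrite andbA.
Qed.

Lemma antidegree_interior_lshift d q i a :
  antidegree d q a -> antidegree d q (Defs.interior (lshift n i) a).
Proof.
move=> ad S; rewrite ffunE; case: ifP => [|_]; first by rewrite eqxx.
rewrite mulf_eq0 negb_or => /andP[_ /ad <-]; congr (_ + _)%N.
apply: eq_card => s; rewrite !inE; case: eqP => [->|] //=.
by rewrite leqNgt ltn_ord andbF.
Qed.

(** The coefficient at S is read off at a set with one more antiholomorphic index, hence the unit
    added to the shift. *)
Lemma antidegree_interior_rshift d q i a :
  antidegree d q a -> antidegree d.+1 q (Defs.interior (rshift n i) a).
Proof.
move=> ad S; rewrite ffunE; case: ifPn => [|iS]; first by rewrite eqxx.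
rewrite mulf_eq0 negb_or => /andP[_ /ad <-].
have -> : antihol_part (rshift n i |: S)%SET =
    (rshift n i |: antihol_part S)%SET.
  apply/setP => s; rewrite !inE; case: eqP => [->|] //=.
  by rewrite leq_addr.
by rewrite cardsU1 !inE (negbTE iS) addnS addSn.
Qed.

Lemma card_hol_antihol S : (#|hol_part S| + #|antihol_part S|)%N = #|S|.
Proof.
rewrite -(cardsID [set s : 'I_(n + n) | (s < n)%N]%SET S).
congr (_ + _)%N; apply: eq_card => s; rewrite !inE // -leqNgt.
by rewrite andbC.
Qed.

Lemma has_type_degree p q a : has_type p q a -> has_degree (p + q) a.
Proof. by move=> at_ S /at_[<- <-]; rewrite card_hol_antihol. Qed.

Lemma has_type_antidegree p q a : has_type p q a -> antidegree 0 q a.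
Proof. by move=> at_ S /at_[_ <-]; rewrite addn0. Qed.

Lemma type01_set a S : has_type 0 1 a -> a S != 0 ->
  exists j, S = [set rshift n j]%SET.
Proof.
move=> a01 aS; have /eqP/cards1P[s eS] := has_type_degree a01 aS.
have [_] := a01 _ aS; rewrite eS; case: (fintype.split_ordP s) => [i ->|j ->].
  rewrite eq_card0 // => u; rewrite !inE; case: eqP => [->|] //=.
  by rewrite leqNgt ltn_ord.
by exists j.
Qed.

Lemma swap_rshift (j : 'I_n) : swap (rshift n j) = lshift n j.
Proof. by rewrite /swap -[rshift n j]/(unsplit (inr j)) unsplitK. Qed.

(** Conjugation turns the single antiholomorphic covector into a holomorphic one. *)
Lemma econj_antidegree a : has_type 0 1 a -> antidegree 0 0 (econj a).
Proof.
move=> a01; apply: antidegree_sum => S _.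
have [aS0|/(type01_set a01)[j ->]] := eqVneq (a S) 0.
  by rewrite aS0 conjc0 scale0r; apply: antidegree0.
apply: antidegreeZ; rewrite enum_set1 big_cons big_nil wedge_1r swap_rshift.
have {2}-> : 0%N = #|antihol_part [set lshift n j]%SET|;
  last exact: antidegree_ebas.
apply/esym/eq_card0 => u; rewrite !inE; case: eqP => [->|] //=.
by rewrite leqNgt ltn_ord.
Qed.

Lemma contr_antidegree f d q a : (forall i, has_type 0 1 (f i)) ->
  antidegree d q a -> antidegree d q.+1 (contr f a).
Proof.
move=> f01 ad; apply: antidegree_sum => i _.
apply: (@antidegree_wedge 0 1); first exact: has_type_antidegree.
exact: antidegree_interior_lshift.
Qed.

Lemma contr_conj_antidegree f d q a : (forall i, has_type 0 1 (f i)) ->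
  antidegree d q a -> antidegree d.+1 q (contr_conj f a).
Proof.
move=> f01 ad; apply: antidegree_sum => i _.
apply: (@antidegree_wedge 0 0); first exact: econj_antidegree.
exact: antidegree_interior_rshift.
Qed.

Lemma hol_setD S : (S :\: hol_part S)%SET = antihol_part S.
Proof.
by apply/setP => s; rewrite !inE; case: (s \in S);
  rewrite ?andbF //= andbT -leqNgt.
Qed.

(** No sign appears, since every holomorphic index precedes every antiholomorphic one. *)
Lemma wedge_hol_antihol S :
  wedge (ebas (hol_part S)) (ebas (antihol_part S)) = ebas S :> ext R n.
Proof.
have hS : hol_part S \subset S by apply/fintype.subsetP => s;
  rewrite !inE => /andP[].
have SE : S = (hol_part S :|: antihol_part S)%SET by
  rewrite -hol_setD -[LHS](finset.setID S (hol_part S)) (finset.setIidPr hS).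
apply/ffunP => U; rewrite ffunE [RHS]ffunE.
have [->|neUS] := eqVneq U S; last first.
  rewrite big1 // => W WU; rewrite !ffunE.
  case: (eqVneq W (hol_part S)) => [eW|_]; last by rewrite mulr0 mul0r.
  case: eqP => [eU|_]; last by rewrite mulr0.
  case/eqP: neUS; rewrite SE -eU -eW finset.setUC.
  by rewrite -[LHS](finset.setID _ W) (finset.setIidPr WU) finset.setUC.
rewrite (bigD1 (hol_part S)) //= big1 ?addr0 => [|W /andP[_ neW]]; last first.
  by rewrite !ffunE (negbTE neW) mulr0 mul0r.
rewrite !ffunE hol_setD !eqxx !mulr1 /inversions eq_card0 ?expr0 // => -[s u].
rewrite !inE /=; apply/negbTE/negP => /andP[/andP[/andP[_ sn] /andP[_ nu]] us].
by have := leq_trans (ltn_trans us sn) nu; rewrite ltnn.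
Qed.

End ContractionTheory.

(** * Derivatives of complex-valued functions *)

Lemma Re_add (R : realType) (x y : R[i]) :
  complex.Re (x + y) = complex.Re x + complex.Re y.
Proof. by case: x y => ? ? []. Qed.

Lemma Im_add (R : realType) (x y : R[i]) :
  complex.Im (x + y) = complex.Im x + complex.Im y.
Proof. by case: x y => ? ? []. Qed.

Lemma Re_mul (R : realType) (x y : R[i]) :
  complex.Re (x * y) =
  complex.Re x * complex.Re y - complex.Im x * complex.Im y.
Proof. by case: x y => ? ? []. Qed.

Lemma Im_mul (R : realType) (x y : R[i]) :
  complex.Im (x * y) =
  complex.Re x * complex.Im y + complex.Im x * complex.Re y.
Proof. by case: x y => ? ? []. Qed.

Lemma Re_conj (R : realType) (x : R[i]) : complex.Re (conjc x) = complex.Re x.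
Proof. by case: x. Qed.

Lemma Im_conj (R : realType) (x : R[i]) : complex.Im (conjc x) = - complex.Im x.
Proof. by case: x. Qed.

Section ComplexDerivatives.
Variables (R : realType) (V : normedModType R).
Implicit Types (f g : V -> R[i]) (x v : V) (k l m : R[i]).

(** Derivability and value travel together, because [cderive] alone has a value even where no
    derivative exists. *)
Definition is_cderive x v f l : Prop :=
  is_derive x v (fun y => complex.Re (f y)) (complex.Re l) /\
  is_derive x v (fun y => complex.Im (f y)) (complex.Im l).

Definition cderivable x v f : Prop :=
  derivable (fun y => complex.Re (f y)) x v /\
  derivable (fun y => complex.Im (f y)) x v.

Lemma cderivableP x v f : cderivable x v f -> is_cderive x v f (cderive f v x).
Proof. by move=> [fr fi]; split; apply: derivableP. Qed.

Lemma is_cderive_derivable x v f l : is_cderive x v f l -> cderivable x v f.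
Proof. by move=> [fr fi]; split; apply: ex_derive. Qed.

Lemma is_cderive_val x v f l : is_cderive x v f l -> cderive f v x = l.
Proof.
by move=> [[_ fr] [_ fi]]; rewrite /cderive fr fi; case: (l).
Qed.

Lemma is_cderive_eq x v f l l' : is_cderive x v f l -> l = l' ->
  is_cderive x v f l'.
Proof. by move=> ? <-. Qed.

Lemma is_cderive_cst x v k : is_cderive x v (fun=> k) 0.
Proof. by split; apply: is_derive_cst. Qed.

Lemma is_cderiveD x v f g l m : is_cderive x v f l -> is_cderive x v g m ->
  is_cderive x v (fun y => f y + g y) (l + m).
Proof.
move=> [fr fi] [gr gi]; split.
  under eq_fun do rewrite Re_add.
  by rewrite Re_add; apply: is_deriveD.
under eq_fun do rewrite Im_add.
by rewrite Im_add; apply: is_deriveD.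
Qed.

Lemma is_cderiveM x v f g l m : is_cderive x v f l -> is_cderive x v g m ->
  is_cderive x v (fun y => f y * g y) (l * g x + f x * m).
Proof.
move=> [fr fi] [gr gi]; split.
  under eq_fun do rewrite Re_mul.
  rewrite Re_add !Re_mul.
  apply: (is_derive_eq (is_deriveB (is_deriveM fr gr) (is_deriveM fi gi))).
  by rewrite /GRing.scale /=; ring.
under eq_fun do rewrite Im_mul.
rewrite Im_add !Im_mul.
apply: (is_derive_eq (is_deriveD (is_deriveM fr gi) (is_deriveM fi gr))).
by rewrite /GRing.scale /=; ring.
Qed.

Lemma is_cderiveZ x v k f l : is_cderive x v f l ->
  is_cderive x v (fun y => k * f y) (k * l).
Proof.
move=> fl; apply: is_cderive_eq (is_cderiveM (is_cderive_cst x v k) fl) _.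
by rewrite mul0r add0r.
Qed.

Lemma is_cderiveB x v f g l m : is_cderive x v f l -> is_cderive x v g m ->
  is_cderive x v (fun y => f y - g y) (l - m).
Proof.
move=> fl gm; apply: is_cderiveD => //; rewrite -mulN1r.
rewrite (_ : (fun y => - g y) = (fun y => -1 * g y)); first exact: is_cderiveZ.
by apply/funext => y; rewrite mulN1r.
Qed.

Lemma is_cderive_sum x v (I : Type) (r : seq I) (P : pred I)
    (F : I -> V -> R[i]) (L : I -> R[i]) :
  (forall i, P i -> is_cderive x v (F i) (L i)) ->
  is_cderive x v (fun y => \sum_(i <- r | P i) F i y) (\sum_(i <- r | P i) L i).
Proof.
move=> FL; elim: r => [|i r IHr].
  under eq_fun do rewrite big_nil.
  by rewrite big_nil; apply: is_cderive_cst.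
under eq_fun do rewrite big_cons.
rewrite big_cons; case: ifP => Pi //.
by apply: is_cderiveD => //; apply: FL.
Qed.

Lemma cderivable_prod x v (I : Type) (r : seq I) (P : pred I)
    (F : I -> V -> R[i]) :
  (forall i, P i -> cderivable x v (F i)) ->
  cderivable x v (fun y => \prod_(i <- r | P i) F i y).
Proof.
move=> FL; elim: r => [|i r IHr].
  under eq_fun do rewrite big_nil.
  exact: is_cderive_derivable (is_cderive_cst x v 1).
under eq_fun do rewrite big_cons.
case Pi: (P i); last exact IHr.
apply: is_cderive_derivable (is_cderiveM (cderivableP (FL i Pi))
  (cderivableP IHr)).
Qed.

Lemma is_cderive_conj x v f l : is_cderive x v f l ->
  is_cderive x v (fun y => conjc (f y)) (conjc l).
Proof.
move=> [fr fi]; split.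
  by under eq_fun do rewrite Re_conj; rewrite Re_conj.
by under eq_fun do rewrite Im_conj; rewrite Im_conj; apply: is_deriveN.
Qed.

Lemma is_cderive_near x v f g l : (\near x, f x = g x) ->
  is_cderive x v f l -> is_cderive x v g l.
Proof.
move=> fg [fr fi].
by split; [apply: (near_eq_is_derive _ fr)|apply: (near_eq_is_derive _ fi)];
  apply: filterS fg => z ->.
Qed.

Lemma cderivableV x v f : f x != 0 -> cderivable x v f ->
  cderivable x v (fun y => (f y)^-1).
Proof.
move=> fx0 [fr fi].
(* Squared modulus: the inverse is the conjugate divided by it, so only a real function has to be
   inverted. *)
pose N y := complex.Re (f y) * complex.Re (f y) +
            complex.Im (f y) * complex.Im (f y).
have N0 : N x != 0.
  apply: contra_neq fx0; rewrite /N; case: (f x) => a b /= /eqP.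
  rewrite -!expr2 paddr_eq0 ?sqr_ge0 // !sqrf_eq0 => /andP[/eqP-> /eqP->].
  by [].
have dN : derivable (fun y => (N y)^-1) x v.
  exact (derivableV N0 (derivableD (derivableM fr fr) (derivableM fi fi))).
have fV y : (f y)^-1 =
    Complex (complex.Re (f y) * (N y)^-1) (- complex.Im (f y) * (N y)^-1).
  by rewrite /N; case: (f y) => a b /=; rewrite -!expr2 mulNr.
split; under eq_fun do rewrite fV /=.
  exact (derivableM fr dN).
exact (derivableM (derivableN fi) dN).
Qed.

End ComplexDerivatives.

(** * Symmetry of second derivatives *)

Lemma subrACA (Z : zmodType) (a b c d : Z) : a - b - (c - d) = a - c - (b - d).
Proof. by rewrite !opprB addrACA [RHS]addrACA [- b - c]addrC. Qed.

Section Schwarz.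
Variables (R : realType) (V : normedModType R).
Implicit Types (f : V -> R) (U : set V) (x u v : V).

Lemma is_derive_line f x u (s : R) : derivable f (s *: u + x) u ->
  is_derive s (1 : R) (fun r : R => f (r *: u + x)) ('D_u f (s *: u + x)).
Proof.
move=> df.
have e : (fun h : R => h^-1 *:
      (((fun r : R => f (r *: u + x)) \o shift s) (h *: (1 : R)) -
       f (s *: u + x))) =
    (fun h : R => h^-1 *:
      ((f \o shift (s *: u + x)) (h *: u) - f (s *: u + x))).
  apply/funext => h /=; congr (_ *: (f _ - _)).
  by rewrite [h *: (1 : R)]mulr1 scalerDl addrA.
by split; rewrite /derivable /derive e.
Qed.

Lemma MVT_line f x u (h : R) : 0 < h ->
  (forall s : R, 0 <= s <= h -> derivable f (s *: u + x) u) ->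
  exists2 s, 0 < s < h & f (h *: u + x) - f x = 'D_u f (s *: u + x) * h.
Proof.
move=> h0 df.
have [| |s] := @MVT R (fun r => f (r *: u + x)) (fun r => 'D_u f (r *: u + x))
  0 h h0.
- move=> s; rewrite in_itv /= => /andP[s0 sh].
  by apply: is_derive_line; apply: df; rewrite !ltW.
- apply: derivable_within_continuous => s; rewrite in_itv /= => s0h.
  by have [] := is_derive_line (df s s0h).
rewrite in_itv /= => s0h e; exists s => //.
by rewrite scale0r add0r subr0 in e.
Qed.

(** The mean value theorem twice: along [u] for the increment in direction [v], then along [v] for
    ['D_u f]. *)
Lemma second_difference f x u v (h : R) : 0 < h ->
  (forall a b : R, 0 <= a <= h -> 0 <= b <= h ->
     derivable f (a *: u + (b *: v + x)) u /\
     derivable ('D_u f) (a *: u + (b *: v + x)) v) ->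
  exists a, exists b, [/\ 0 < a < h, 0 < b < h &
    f (h *: u + (h *: v + x)) - f (h *: v + x) - (f (h *: u + x) - f x)
    = 'D_v ('D_u f) (a *: u + (b *: v + x)) * h * h].
Proof.
move=> h0 df.
have hh : 0 <= h <= h by apply/andP; split; [exact: ltW|exact: lexx].
have z0h : 0 <= (0 : R) <= h by rewrite lexx ltW.
have dfv (a b : R) : 0 <= a <= h -> 0 <= b <= h ->
    derivable ('D_u f) (b *: v + (a *: u + x)) v.
  by move=> ah bh; rewrite addrCA; have [] := df a b ah bh.
(* The increment of [G] along [u] is the second difference of [f]. *)
pose G y := f (y + h *: v) - f y.
have dG (s : R) : 0 <= s <= h -> is_derive (s *: u + x) u G
    ('D_u f (s *: u + (h *: v + x)) - 'D_u f (s *: u + x)).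
  move=> sh; apply: is_deriveB; last first.
    by apply: derivableP; have [] := df s 0 sh z0h; rewrite scale0r add0r.
  have [] := df s h sh hh; rewrite [h *: v + x]addrC addrA => d1 _.
  have e : (fun k : R => k^-1 *:
        (((fun y => f (y + h *: v)) \o shift (s *: u + x)) (k *: u) -
         f (s *: u + x + h *: v))) =
      (fun k : R => k^-1 *:
        ((f \o shift (s *: u + x + h *: v)) (k *: u) -
         f (s *: u + x + h *: v))).
    by apply/funext => k /=; rewrite !addrA.
  by split; rewrite /derivable /derive e.
have dG' s : 0 <= s <= h -> derivable G (s *: u + x) u.
  by move=> sh; have [] := dG s sh.
have [a ah] := MVT_line h0 dG'.
have ah' : 0 <= a <= h by case/andP: ah => *; rewrite !ltW.
have [_ ->] := dG a ah'.
have [b bh] := MVT_line h0 (fun b bh => dfv a b ah' bh).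
rewrite ![b *: v + _]addrCA [h *: v + (a *: u + x)]addrCA => -> e.
exists a, b; split=> //; rewrite -e /G.
by rewrite -[h *: u + x + _]addrA [x + _]addrC subrACA.
Qed.

(** The second difference is symmetric in [u] and [v], so the two mixed derivatives share a value,
    taken at two points arbitrarily near [x]; continuity then excludes a gap at [x]. *)
Lemma Schwarz f U x u v : open U -> U x -> Ck 2 U f ->
  'D_u ('D_v f) x = 'D_v ('D_u f) x.
Proof.
move=> oU Ux [_ f2].
have [dfu [_ f2u]] := f2 u; have [dfv [_ f2v]] := f2 v.
have [dfuv [cuv _]] := f2u v; have [dfvu [cvu _]] := f2v u.
apply/eqP; rewrite -subr_eq0 -normr_le0 leNgt; apply/negP => e0.
move eE : `|_| e0 => e e0.
have nP : \forall y \near x,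
    [/\ U y, `|'D_v ('D_u f) x - 'D_v ('D_u f) y| < e / 2 &
        `|'D_u ('D_v f) x - 'D_u ('D_v f) y| < e / 2].
  have e20 : 0 < e / 2 by rewrite divr_gt0.
  have /cvgrPdist_lt/(_ _ e20) c1 := cuv x Ux.
  have /cvgrPdist_lt/(_ _ e20) c2 := cvu x Ux.
  have nU : \forall y \near x, U y by apply: open_nbhs_nbhs.
  have e4 : nbhs x
      ((U `&` (fun y => `|'D_v ('D_u f) x - 'D_v ('D_u f) y| < e / 2)) `&`
       (fun y => `|'D_u ('D_v f) x - 'D_u ('D_v f) y| < e / 2)).
    by apply: filterI; [apply: filterI; [exact nU|exact c1]|exact c2].
  by apply: (filterS _ e4) => y [[Uy n1] n2]; split;
    [exact Uy|exact n1|exact n2].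
have /nbhs_normP[d d0 dP] := nP.
(* Displacements by a u + b v with a and b at most h have norm at most h m = d / 2; the summand 1
   keeps m positive. *)
pose m := `|u| + `|v| + 1.
have m0 : 0 < m by rewrite ltr_wpDl ?addr_ge0.
pose h := d / m / 2.
have h0 : 0 < h by rewrite !divr_gt0.
have near_pt (a b : R) : 0 <= a <= h -> 0 <= b <= h ->
    ball_ Num.norm x d (a *: u + (b *: v + x)).
  move=> /andP[a0 ah] /andP[b0 bh].
  rewrite /ball_ /= addrA opprD addrCA subrr addr0 normrN.
  apply: (le_lt_trans (ler_normD _ _)); rewrite !normrZ !ger0_norm //.
  apply: (@le_lt_trans _ _ (h * m)).
    rewrite /m !mulrDr mulr1 -[leLHS]addr0.
    by apply: lerD; [apply: lerD; exact: ler_wpM2r|exact: ltW].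
  rewrite /h mulrAC divfK ?gt_eqF // ltr_pdivrMr // ltr_pMr // ltr1n //.
have [|a [b [ah bh eq1]]] := @second_difference f x u v h h0.
  by move=> a b ah bh; have [? _ _] := dP _ (near_pt a b ah bh); split;
    [apply: dfu|apply: dfuv].
have [|a' [b' [ah' bh' eq2]]] := @second_difference f x v u h h0.
  by move=> a' b' ah' bh'; have [? _ _] := dP _ (near_pt b' a' bh' ah') => //;
    rewrite addrCA; split; [apply: dfv|apply: dfvu].
have W (s : R) : 0 < s < h -> 0 <= s <= h by case/andP => *; rewrite !ltW.
have [_ n1 _] := dP _ (near_pt a b (W _ ah) (W _ bh)).
have [_ _ n2] := dP _ (near_pt b' a' (W _ bh') (W _ ah')).
have mid : f (h *: u + (h *: v + x)) - f (h *: v + x) - (f (h *: u + x) - f x)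
    = f (h *: v + (h *: u + x)) - f (h *: u + x) - (f (h *: v + x) - f x).
  by rewrite [h *: v + (h *: u + x)]addrCA subrACA.
(* Both mean values carry the factor h * h, whose cancellation equates one mixed derivative at the
   first point with the other at the second. *)
have := etrans (etrans (esym eq1) mid) eq2; rewrite [a' *: v + _]addrCA.
move: eE n1 n2; clear -h0.
move: ('D_u _ _) ('D_v _ _) ('D_v _ _) ('D_u _ _) => A B C D eE n1 n2.
move=> /(mulIf (lt0r_neq0 h0))/(mulIf (lt0r_neq0 h0)) eBA.
have : e < e / 2 + e / 2.
  rewrite -[ltLHS]eE -(subrK A D) -addrA.
  by apply: le_lt_trans (ler_normD _ _) _; rewrite ltrD // -eBA distrC.
by rewrite -splitr ltxx.
Qed.

(** * Stability of the classes C^k under sums and products *)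

Lemma Ck_ext k U f g : open U -> (forall x, U x -> f x = g x) ->
  Ck k U f -> Ck k U g.
Proof.
move=> oU; elim: k f g => [|k IHk] f g fg [cf df].
  split=> // x Ux; rewrite /prop_for /continuous_at -(fg _ Ux).
  apply: cvg_trans (cf x Ux); apply: near_eq_cvg.
  by apply: filterS (open_nbhs_nbhs (conj oU Ux)) => y /fg.
have nfg x : U x -> \near x, f x = g x.
  by move=> Ux; apply: filterS (open_nbhs_nbhs (conj oU Ux)) => y /fg.
split=> [x Ux|v].
  rewrite /prop_for /continuous_at -(fg _ Ux).
  by apply: cvg_trans (cf x Ux); apply: near_eq_cvg; exact: nfg.
have [dfv Dfv] := df v; split=> [x Ux|].
  by apply: near_eq_derivable (dfv x Ux); exact: nfg.
apply: IHk Dfv => x Ux; apply: near_eq_derive; exact: nfg.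
Qed.

Lemma Ck_pred k U f : Ck k.+1 U f -> Ck k U f.
Proof.
elim: k f => [|k IHk] f [cf df]; split=> // v.
by have [dfv Dfv] := df v; split=> //; apply: IHk.
Qed.

Lemma Ck_cst k U (c : R) : Ck k U (cst c : V -> R).
Proof.
elim: k c => [|k IHk] c; split=> //; try by move=> x _; exact: cvg_cst.
move=> v; split=> [x _|]; first exact: derivable_cst.
rewrite (_ : 'D_v _ = cst 0) //; apply/funext => x.
exact: derive_cst.
Qed.

(** The rule for the derivative of a sum holds on U only, so the induction passes through [Ck_ext],
    where U is open. *)
Lemma CkD k U f g : open U -> Ck k U f -> Ck k U g ->
  Ck k U (fun x => f x + g x).
Proof.
move=> oU; elim: k f g => [|k IHk] f g [cf df] [cg dg].
  by split=> // x Ux; apply: cvgD; [apply: cf|apply: cg].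
split=> [x Ux|v]; first by apply: cvgD; [apply: cf|apply: cg].
have [dfv Dfv] := df v; have [dgv Dgv] := dg v; split=> [x Ux|].
  exact (derivableD (dfv x Ux) (dgv x Ux)).
apply: Ck_ext (IHk _ _ Dfv Dgv) => // x Ux.
exact (esym (deriveD (dfv x Ux) (dgv x Ux))).
Qed.

Lemma CkM k U f g : open U -> Ck k U f -> Ck k U g ->
  Ck k U (fun x => f x * g x).
Proof.
move=> oU; elim: k f g => [|k IHk] f g Cf Cg; have [cf df] := Cf;
  have [cg dg] := Cg.
  by split=> // x Ux; apply: cvgM; [apply: cf|apply: cg].
split=> [x Ux|v]; first by apply: cvgM; [apply: cf|apply: cg].
have [dfv Dfv] := df v; have [dgv Dgv] := dg v; split=> [x Ux|].
  exact (derivableM (dfv x Ux) (dgv x Ux)).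
apply: Ck_ext (CkD oU (IHk _ _ (Ck_pred Cf) Dgv) (IHk _ _ (Ck_pred Cg) Dfv))
  => // x Ux.
exact (esym (deriveM (dfv x Ux) (dgv x Ux))).
Qed.

Lemma csmoothD U (f g : V -> R[i]) : open U -> csmooth U f -> csmooth U g ->
  csmooth U (fun x => f x + g x).
Proof.
move=> oU [fr fi] [gr gi]; split=> k.
  by under eq_fun do rewrite Re_add; apply: CkD.
by under eq_fun do rewrite Im_add; apply: CkD.
Qed.

Lemma csmooth_cst U (c : R[i]) : csmooth U (fun _ : V => c).
Proof. by split=> k; apply: Ck_cst. Qed.

Lemma csmoothM U (f g : V -> R[i]) : open U -> csmooth U f -> csmooth U g ->
  csmooth U (fun x => f x * g x).
Proof.
move=> oU [fr fi] [gr gi]; split=> k.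
  under eq_fun do rewrite Re_mul -mulN1r.
  apply: CkD => //; first exact: CkM.
  by apply: CkM => //; [apply: Ck_cst|apply: CkM].
by under eq_fun do rewrite Im_mul; apply: CkD => //; apply: CkM.
Qed.

Lemma csmooth_sum U (I : Type) (r : seq I) (P : pred I) (F : I -> V -> R[i]) :
  open U -> (forall i, P i -> csmooth U (F i)) ->
  csmooth U (fun x => \sum_(i <- r | P i) F i x).
Proof.
move=> oU FL; elim: r => [|i r IHr].
  by under eq_fun do rewrite big_nil; apply: csmooth_cst.
under eq_fun do rewrite big_cons.
case Pi: (P i); last exact IHr.
by apply: csmoothD => //; apply: FL.
Qed.

End Schwarz.

(** * Differentiating the exterior derivative in time *)

Section TimeSlices.
Variables (R : realType) (V : normedModType R).
Implicit Types (g : V * R -> R) (F : V * R -> R[i]).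

Lemma space_slice g v y t :
  (fun h : R => h^-1 *:
    (((fun z => g (z, t)) \o shift y) (h *: v) - g (y, t))) =
  (fun h : R => h^-1 *: ((g \o shift (y, t)) (h *: (v, 0 : R)) - g (y, t))).
Proof.
apply/funext => h /=; congr (_ *: (g _ - _)).
by congr (_, _); rewrite /= [h *: (0 : R)]mulr0 add0r.
Qed.

(** Equality of the difference quotients themselves, so that existence and value of the derivative
    transfer alike. *)
Lemma time_slice g y t :
  (fun h : R => h^-1 *:
    (((fun s => g (y, s)) \o shift t) (h *: (1 : R)) - g (y, t))) =
  (fun h : R => h^-1 *: ((g \o shift (y, t)) (h *: (0 : V, 1 : R)) - g (y, t))).
Proof.
apply/funext => h /=; congr (_ *: (g _ - _)).
by congr (_, _); rewrite /= scaler0 add0r.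
Qed.

Lemma derive_space_slice g v y t :
  'D_v (fun z => g (z, t)) y = 'D_(v, 0 : R) g (y, t).
Proof. by rewrite /derive space_slice. Qed.

Lemma derive_time_slice g y t :
  'D_1 (fun s => g (y, s)) t = 'D_(0 : V, 1 : R) g (y, t).
Proof. by rewrite /derive time_slice. Qed.

Lemma derivable_time_slice g y t :
  derivable g (y, t) (0 : V, 1 : R) -> derivable (fun s => g (y, s)) t 1.
Proof. by rewrite /derivable time_slice. Qed.

Lemma cderive1E (f : R -> R[i]) t : cderive1 f t = cderive f 1 t.
Proof. by rewrite /cderive1 !derive1E. Qed.

Lemma csmooth_time_derivable (D : set (V * R)) F y t : D (y, t) ->
  csmooth D F -> cderivable t 1 (fun s => F (y, s)).
Proof.
move=> Dy [/(_ 1%N)[_ /(_ (0, 1))[dr _]] /(_ 1%N)[_ /(_ (0, 1))[di _]]].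
by split; apply: (@derivable_time_slice (fun p => _ (F p)));
  [apply: dr|apply: di].
Qed.

(** Space and time are the directions (v, 0) and (0, 1) of the product space, where the symmetry of
    second derivatives applies. *)
Lemma smooth_derive_swap (D : set (V * R)) g v y t :
  open D -> D (y, t) -> Ck 2 D g ->
  is_derive t (1 : R) (fun s => 'D_v (fun z => g (z, s)) y)
    ('D_v (fun z => 'D_1 (fun s => g (z, s)) t) y).
Proof.
move=> oD Dy g2.
under eq_fun do rewrite derive_space_slice.
under [X in is_derive _ _ _ ('D_v X _)]eq_fun do rewrite derive_time_slice.
rewrite (derive_space_slice ('D_(0 : V, 1 : R) g)) (Schwarz _ _ oD Dy g2).
rewrite -(derive_time_slice ('D_(v, 0 : R) g)); apply: derivableP.
apply: (@derivable_time_slice ('D_(v, 0 : R) g)).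
have [_ /(_ (v, 0))[_ [_ /(_ (0, 1))[dd _]]]] := g2.
exact: dd.
Qed.

Lemma cderive_swap (D : set (V * R)) F v y t :
  open D -> D (y, t) -> csmooth D F ->
  is_cderive t 1 (fun s => cderive (fun z => F (z, s)) v y)
    (cderive (fun z => cderive1 (fun s => F (z, s)) t) v y).
Proof.
move=> oD Dy [Fr Fi].
under [X in is_cderive _ _ _ (cderive X _ _)]eq_fun do rewrite cderive1E.
by split; [exact: (smooth_derive_swap v oD Dy (Fr 2%N))
          |exact: (smooth_derive_swap v oD Dy (Fi 2%N))].
Qed.

End TimeSlices.

Section ExteriorDerivative.
Variables (R : realType) (n : nat).
Local Notation E := 'rV[R]_(n + n).

Lemma wirtinger_swap (D : set (E * R)) (F : E * R -> R[i]) s y t :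
  open D -> D (y, t) -> csmooth D F ->
  is_cderive t (1 : R) (fun r => wirtinger s (fun z => F (z, r)) y)
    (wirtinger s (fun z => cderive1 (fun r => F (z, r)) t) y).
Proof.
move=> oD Dy F2; rewrite /wirtinger; case: (fintype.split s) => i.
  by apply: is_cderiveZ; apply: is_cderiveB; [|apply: is_cderiveZ];
    apply: cderive_swap F2.
by apply: is_cderiveZ; apply: is_cderiveD; [|apply: is_cderiveZ];
  apply: cderive_swap F2.
Qed.

Lemma delE (al : E -> ext R n) y (U : {set 'I_(n + n)}) : del al y U =
  \sum_(i < n) if lshift n i \in U then
    (-1) ^+ #|[set u in U | (u < lshift n i)%N]%SET| *
      wirtinger (lshift n i) (fun z => al z (U :\ lshift n i)%SET) y else 0.
Proof.
by rewrite ext_sumE; apply: eq_bigr => i _; rewrite wedge_ecovE ffunE.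
Qed.

Lemma delbarE (al : E -> ext R n) y (U : {set 'I_(n + n)}) : delbar al y U =
  \sum_(i < n) if rshift n i \in U then
    (-1) ^+ #|[set u in U | (u < rshift n i)%N]%SET| *
      wirtinger (rshift n i) (fun z => al z (U :\ rshift n i)%SET) y else 0.
Proof.
by rewrite ext_sumE; apply: eq_bigr => i _; rewrite wedge_ecovE ffunE.
Qed.

Lemma extdE (al : E -> ext R n) y (U : {set 'I_(n + n)}) :
  extd al y U = del al y U + delbar al y U.
Proof. exact: ext_addE. Qed.

Lemma extd_coefE (al : E -> ext R n) y (U : {set 'I_(n + n)}) : extd al y U =
  \sum_(i < n) (if lshift n i \in U then
    (-1) ^+ #|[set u in U | (u < lshift n i)%N]%SET| *
      wirtinger (lshift n i) (fun z => al z (U :\ lshift n i)%SET) y else 0) +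
  \sum_(i < n) (if rshift n i \in U then
    (-1) ^+ #|[set u in U | (u < rshift n i)%N]%SET| *
      wirtinger (rshift n i) (fun z => al z (U :\ rshift n i)%SET) y else 0).
Proof.
apply: (etrans (extdE al y U)).
by congr (_ + _); [exact: delE|exact: delbarE].
Qed.

(** In the chart d has constant coefficients, so it commutes with the time derivative; the function
    of time being differentiated vanishes near [t]. *)
Lemma extd_time_deriv (D : set (E * R)) (J : set R)
    (al : R -> E -> ext R n) y t :
  open D -> D (y, t) -> (forall S, csmooth D (fun p => al p.2 p.1 S)) ->
  open J -> J t -> (forall r, J r -> extd (al r) y = 0) ->
  extd (fun z => [ffun S => cderive1 (fun r => al r z S) t]) y = 0.
Proof.
move=> oD Dy al2 oJ Jt d0; apply/ffunP => U; rewrite [RHS]ffunE.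
have dw s S : is_cderive t (1 : R) (fun r => wirtinger s (fun z => al r z S) y)
    (wirtinger s (fun z => [ffun S => cderive1 (fun r => al r z S) t] S) y).
  under [X in is_cderive _ _ _ (wirtinger _ X _)]eq_fun do rewrite ffunE.
  exact: (wirtinger_swap s oD Dy (al2 S)).
have dt : is_cderive t (1 : R) (fun r => extd (al r) y U)
    (extd (fun z => [ffun S => cderive1 (fun r => al r z S) t]) y U).
  apply: is_cderive_eq _ (esym (extd_coefE _ _ _)).
  under eq_fun do rewrite extd_coefE.
  apply: is_cderiveD; apply: is_cderive_sum => i _.
    case: (lshift n i \in U); last exact: is_cderive_cst.
    by apply: is_cderiveZ; exact: dw.
  case: (rshift n i \in U); last exact: is_cderive_cst.
  by apply: is_cderiveZ; exact: dw.
rewrite -(is_cderive_val dt); apply: is_cderive_val.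
apply: is_cderive_near (is_cderive_cst t 1 0).
by apply: filterS (open_nbhs_nbhs (conj oJ Jt)) => r /d0->; rewrite ffunE.
Qed.

End ExteriorDerivative.

(** * First variation of the extension map *)

Lemma cderivable_det (R : realType) (m : nat) (M : R -> 'M[R[i]]_m) t :
  (forall i j, cderivable t (1 : R) (fun r => M r i j)) ->
  cderivable t (1 : R) (fun r => \det (M r)).
Proof.
move=> dM; rewrite /determinant.
apply: is_cderive_derivable; apply: is_cderive_sum => s _.
apply: is_cderiveZ; apply: cderivableP; apply: cderivable_prod => i _.
exact: dM.
Qed.

(** A positive real part persists near [t] by continuity, and it excludes zero. *)
Lemma cderivable_near_neq0 (R : realType) (f : R -> R[i]) t :
  cderivable t (1 : R) f -> f t = 1 -> \forall r \near t, f r != 0.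
Proof.
move=> [/derivable1_diffP/differentiable_continuous fr _] ft.
have : \forall r \near t, 0 < complex.Re (f r).
  by apply: (cvgr_gt _ fr); rewrite ft; exact: ltr01.
by apply: filterS => r; apply: contraTneq => ->; rewrite ltxx.
Qed.

Section Ext.
Variables (R : realType) (n : nat).
Implicit Types (t : R) (f g : R -> ext R n) (l m : ext R n).

Definition is_ederive t f l : Prop :=
  forall S, is_cderive t (1 : R) (fun r => f r S) (l S).

Lemma is_ederive_unique t f l m : is_ederive t f l -> is_ederive t f m -> l = m.
Proof.
move=> fl fm; apply/ffunP => S.
by rewrite -(is_cderive_val (fl S)) (is_cderive_val (fm S)).
Qed.

Lemma is_ederive_eq t f l m : is_ederive t f l -> l = m -> is_ederive t f m.
Proof. by move=> ? <-. Qed.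

Lemma is_ederive_near t f g l : (\forall r \near t, f r = g r) ->
  is_ederive t f l -> is_ederive t g l.
Proof.
move=> fg fl S; apply: (is_cderive_near _ (fl S)).
by apply: filterS fg => r ->.
Qed.

Lemma is_ederive_cst t a : is_ederive t (fun=> a) 0.
Proof. by move=> S; rewrite ffunE; apply: is_cderive_cst. Qed.

Lemma is_ederive_sum t (I : Type) (r : seq I) (P : pred I)
    (F : I -> R -> ext R n) (L : I -> ext R n) :
  (forall i, P i -> is_ederive t (F i) (L i)) ->
  is_ederive t (fun s => \sum_(i <- r | P i) F i s) (\sum_(i <- r | P i) L i).
Proof.
move=> FL S; under eq_fun do rewrite ext_sumE.
by rewrite ext_sumE; apply: is_cderive_sum => i Pi; apply: FL.
Qed.

Lemma is_ederiveZ t (k : R -> R[i]) (p : R[i]) f l :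
  is_cderive t (1 : R) k p -> is_ederive t f l ->
  is_ederive t (fun r => k r *: f r) (p *: f t + k t *: l).
Proof.
move=> kp fl S; under eq_fun do rewrite ext_scaleE.
rewrite ffunE !ext_scaleE; exact: is_cderiveM.
Qed.

Lemma is_ederiveZc t (k : R[i]) f l : is_ederive t f l ->
  is_ederive t (fun r => k *: f r) (k *: l).
Proof.
move=> fl S; under eq_fun do rewrite ext_scaleE.
rewrite ext_scaleE; exact: is_cderiveZ.
Qed.

Lemma is_ederive_wedge t f g l m : is_ederive t f l -> is_ederive t g m ->
  is_ederive t (fun r => wedge (f r) (g r)) (wedge l (g t) + wedge (f t) m).
Proof.
move=> fl gm S; under eq_fun do rewrite ffunE.
rewrite !ffunE -big_split; apply: is_cderive_sum => U _.
under eq_fun do rewrite -mulrA; rewrite -!mulrA /= -mulrDr.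
by apply: is_cderiveZ; apply: is_cderiveM.
Qed.

Lemma is_ederive_interior t s f l : is_ederive t f l ->
  is_ederive t (fun r => Defs.interior s (f r)) (Defs.interior s l).
Proof.
move=> fl S; under eq_fun do rewrite ffunE.
rewrite ffunE; case: (s \in S); first exact: is_cderive_cst.
exact: is_cderiveZ.
Qed.

Lemma is_ederive_econj t f l : is_ederive t f l ->
  is_ederive t (fun r => econj (f r)) (econj l).
Proof.
move=> fl; apply: is_ederive_sum => S _.
apply: is_ederive_eq
  (is_ederiveZ (is_cderive_conj (fl S)) (is_ederive_cst t _)) _.
by rewrite scaler0 addr0.
Qed.

Lemma econj0 : econj 0 = 0 :> ext R n.
Proof. by rewrite /econj big1 // => S _; rewrite ffunE conjc0 scale0r. Qed.

Section AtZero.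
Variables (t : R) (f : R -> 'I_n -> ext R n) (l : 'I_n -> ext R n).
Hypothesis fl : forall i, is_ederive t (f^~ i) (l i).
Hypothesis ft : forall i, f t i = 0.

Lemma contr_at0 a : contr (f t) a = 0.
Proof. by rewrite /contr big1 // => i _; rewrite ft wedge0l. Qed.

Lemma contr_conj_at0 a : contr_conj (f t) a = 0.
Proof. by rewrite /contr_conj big1 // => i _; rewrite ft econj0 wedge0l. Qed.

(** The product-rule term with the derivative of [g] carries the factor [f t = 0], so [m] is absent
    from the result. *)
Lemma is_ederive_contr g m : is_ederive t g m ->
  is_ederive t (fun r => contr (f r) (g r)) (contr l (g t)).
Proof.
move=> gm; apply: is_ederive_sum => i _.
apply: is_ederive_eq (is_ederive_wedge (fl i) (is_ederive_interior _ gm)) _.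
by rewrite ft wedge0l addr0.
Qed.

Lemma is_ederive_contr_conj g m : is_ederive t g m ->
  is_ederive t (fun r => contr_conj (f r) (g r)) (contr_conj l (g t)).
Proof.
move=> gm; apply: is_ederive_sum => i _.
apply: is_ederive_eq
  (is_ederive_wedge (is_ederive_econj (fl i)) (is_ederive_interior _ gm)) _.
by rewrite ft econj0 wedge0l addr0.
Qed.

End AtZero.

Lemma contr_conj0 (f : 'I_n -> ext R n) : contr_conj f 0 = 0.
Proof.
by rewrite /contr_conj big1 // => i _; rewrite interior_zero wedge0r.
Qed.

Section ExpAtZero.
Variables (t : R) (G : R -> ext R n -> ext R n) (L : ext R n -> ext R n).
Hypothesis Gt : forall a, G t a = 0.

Lemma iter_at0 k a : iter k.+1 (G t) a = 0.
Proof. exact: Gt. Qed.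

Lemma exp_op_at0 a : exp_op (G t) a = a.
Proof.
rewrite /exp_op big_ord_recl big1 => [|k _];
  first by rewrite addr0 /= invr1 scale1r.
by rewrite iter_at0 scaler0.
Qed.

Hypothesis GL : forall g m, is_ederive t g m ->
  is_ederive t (fun r => G r (g r)) (L (g t)).
Hypothesis L0 : L 0 = 0.

(** [G] stands for either contraction. From the second iterate on, the derivative is [L] of an
    iterate that vanishes at [t]. *)
Lemma is_ederive_exp_op a : (0 < n)%N ->
  is_ederive t (fun r => exp_op (G r) a) (L a).
Proof.
move=> n0; pose D k := if k is k'.+1 then L (iter k' (G t) a) else 0.
have dk k : is_ederive t (fun r => iter k (G r) a) (D k).
  elim: k => [|k IHk]; first exact: is_ederive_cst.
  exact: GL IHk.
have e : is_ederive t (fun r => exp_op (G r) a)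
    (\sum_(k < n.+1) (k`!%:R)^-1 *: D k).
  by apply: is_ederive_sum => k _; apply: is_ederiveZc.
(* The linear term is the one that survives; index 1 is in range because [0 < n]. *)
apply: is_ederive_eq e _; rewrite (bigD1 (Ordinal (n0 : 1 < n.+1)%N)) //=.
rewrite invr1 scale1r big1 ?addr0 // => -[[|[|k]] /= kn] neq //.
  by rewrite scaler0.
by rewrite Gt L0 scaler0.
Qed.

End ExpAtZero.

Lemma contr_antihol0 (f : 'I_n -> ext R n) (S : {set 'I_(n + n)}) :
  contr f (ebas (antihol_part S)) = 0.
Proof.
rewrite /contr big1 // => i _; rewrite interior_ebas0 ?wedge0r // inE /=.
by rewrite leqNgt ltn_ord andbF.
Qed.

(** Image of the basis element of index S: [extmap f a] unfolds to the combination of these with the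
    coefficients of [a]. *)
Definition extbas (f : 'I_n -> ext R n) (S : {set 'I_(n + n)}) : ext R n :=
  wedge (exp_op (contr f) (ebas (hol_part S)))
        (exp_op (contr_conj f) (ebas (antihol_part S))).

Lemma extbas_at0 (f : R -> 'I_n -> ext R n) t S : (forall i, f t i = 0) ->
  extbas (f t) S = ebas S.
Proof.
move=> ft; rewrite /extbas (@exp_op_at0 t (fun r => contr (f r)))
  ?(@exp_op_at0 t (fun r => contr_conj (f r))).
- exact: wedge_hol_antihol.
- exact: contr_conj_at0.
- exact: contr_at0.
Qed.

Lemma is_ederive_extbas (f : R -> 'I_n -> ext R n) (l : 'I_n -> ext R n)
    t S : (0 < n)%N ->
  (forall i, is_ederive t (f^~ i) (l i)) -> (forall i, f t i = 0) ->
  (forall i, has_degree 1 (l i)) ->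
  is_ederive t (fun r => extbas (f r) S)
    (contr l (ebas S) +
     wedge (ebas (hol_part S)) (contr_conj l (ebas (antihol_part S)))).
Proof.
move=> n0 fl ft l1.
have c0 := @contr_at0 t f ft; have cc0 := @contr_conj_at0 t f ft.
have d1 := @is_ederive_exp_op t (fun r => contr (f r)) (contr l) c0
  (@is_ederive_contr t f l fl ft) (contr0 l) (ebas (hol_part S)) n0.
have d2 := @is_ederive_exp_op t (fun r => contr_conj (f r)) (contr_conj l) cc0
  (@is_ederive_contr_conj t f l fl ft) (contr_conj0 l)
  (ebas (antihol_part S)) n0.
apply: is_ederive_eq (is_ederive_wedge d1 d2) _.
rewrite (@exp_op_at0 t (fun r => contr (f r)) c0).
rewrite (@exp_op_at0 t (fun r => contr_conj (f r)) cc0).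
(* [contr l] is a derivation that vanishes on the antiholomorphic factor, so it may be applied to
   the whole basis element. *)
congr (_ + _); rewrite -(wedge_hol_antihol _ S) contr_wedge //.
by rewrite contr_antihol0 wedge0r addr0.
Qed.

Lemma ederivable_solve t (B : R -> {set 'I_(n + n)} -> ext R n)
    (w b : R -> ext R n) :
  (forall S, exists L, is_ederive t (B^~ S) L) -> (forall S, B t S = ebas S) ->
  (exists L, is_ederive t b L) ->
  (\forall r \near t, b r = \sum_S w r S *: B r S) ->
  exists l, is_ederive t w l.
Proof.
move=> dB Bt [Lb db] wB.
pose I := {set 'I_(n + n)}.
pose ev : 'I_#|{: I}| -> I := enum_val.
pose M r : 'M[R[i]]_#|{: I}| := \matrix_(i, j) B r (ev i) (ev j).
have dM i j : cderivable t (1 : R) (fun r => M r i j).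
  have [L dL] := dB (ev i); under eq_fun do rewrite mxE.
  exact: is_cderive_derivable (dL (ev j)).
have Mt : M t = 1%:M.
  apply/matrixP => i j; rewrite !mxE Bt ffunE (inj_eq enum_val_inj).
  by rewrite eq_sym.
have ddet := cderivable_det dM.
have det_t : \det (M t) = 1 by rewrite Mt det1.
have dadj i j : cderivable t (1 : R) (fun r => (\adj (M r)) i j).
  rewrite /adjugate /cofactor; under eq_fun do rewrite mxE.
  apply: is_cderive_derivable; apply: is_cderiveZ; apply: cderivableP.
  apply: cderivable_det => i' j'; under eq_fun do rewrite !mxE.
  have := dM (lift j i') (lift i j').
  by under [X in cderivable _ _ X -> _]eq_fun do rewrite mxE.
(* Cramer's formula, defined for every r; it equals [w] where the linear system holds and the
   determinant is nonzero, hence near [t]. The rows of [M r] are the [B r S], so [w] enters as a row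
   vector on the left. *)
pose rhs r S := (\sum_j b r (ev j) * (\adj (M r)) j (enum_rank S)) *
  (\det (M r))^-1.
have drhs S : cderivable t (1 : R) (rhs^~ S).
  apply: is_cderive_derivable; apply: is_cderiveM; last first.
    by apply: cderivableP; apply: cderivableV => //; rewrite det_t oner_neq0.
  apply: is_cderive_sum => j _; apply: is_cderiveM; first exact: db.
  exact: cderivableP.
exists [ffun S => cderive (rhs^~ S) (1 : R) t] => S; rewrite ffunE.
apply: is_cderive_near (cderivableP (drhs S)).
apply: filterS2 wB (cderivable_near_neq0 ddet det_t) => r wBr det0.
rewrite /rhs; apply: (canLR (mulfK det0)).
pose v : 'rV[R[i]]_#|{: I}| := \row_i w r (ev i).
pose bv : 'rV[R[i]]_#|{: I}| := \row_i b r (ev i).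
have vM : v *m M r = bv.
  apply/rowP => j; rewrite !mxE wBr ext_sumE.
  rewrite [RHS](reindex ev) /=; last exact: onW_bij (enum_val_bij I).
  by apply: eq_bigr => i _; rewrite !mxE ext_scaleE.
have := congr1 (fun A => (A *m \adj (M r)) 0 (enum_rank S)) vM.
rewrite -mulmxA mul_mx_adj mul_mx_scalar !mxE /ev enum_rankK mulrC => ->.
by apply: eq_bigr => j _; rewrite !mxE.
Qed.

End Ext.

(** * First variation of the powers *)

Section Powers.
Variables (R : realType) (n : nat).
Implicit Types (a b : ext R n) (S U : {set 'I_(n + n)}).

(** Together with [wedge_add_law], gives access to the generic expansion of a product of sums, which
    rests on an absorbing zero and distributivity. *)
Definition wedge_mul_law : Monoid.mul_law (0 : ext R n) :=
  HB.pack (@wedge R n) (Monoid.isMulLaw.Build _ _ _ (@wedge0l R n)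
    (@wedge0r R n)).

Definition wedge_add_law : Monoid.add_law 0 wedge_mul_law :=
  HB.pack (+%R : ext R n -> ext R n -> ext R n)
    (Monoid.isComLaw.Build _ (0 : ext R n) +%R (@addrA _) (@addrC _) (@add0r _))
    (Monoid.isAddLaw.Build _ (wedge_mul_law : ext R n -> ext R n -> ext R n)
      (+%R : ext R n -> ext R n -> ext R n) (@wedgeDl R n) (@wedgeDr R n)).

Lemma wedge_prod_sum (m : nat) (J : finType) (F : 'I_m -> J -> ext R n) :
  \big[@wedge R n/ebas finset.set0]_(k < m) \sum_j F k j =
  \sum_(g : {ffun 'I_m -> J})
    \big[@wedge R n/ebas finset.set0]_(k < m) F k (g k).
Proof. exact: (@bigA_distr_bigA _ _ _ wedge_mul_law wedge_add_law). Qed.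

Lemma wedge_prodZ (m : nat) (k : 'I_m -> R[i]) (F : 'I_m -> ext R n) :
  \big[@wedge R n/ebas finset.set0]_(i < m) (k i *: F i) =
  (\prod_i k i) *: \big[@wedge R n/ebas finset.set0]_(i < m) F i.
Proof.
elim/big_rec3: _ => [|i x p y _ ->]; first by rewrite scale1r.
by rewrite wedgeZl wedgeZr scalerA.
Qed.

Lemma wpow_bigE a m : wpow a m = \big[@wedge R n/ebas finset.set0]_(k < m) a.
Proof. by rewrite big_const_ord. Qed.

Lemma hol_part_pair (i j : 'I_n) :
  hol_part [set lshift n i; rshift n j]%SET = [set lshift n i]%SET.
Proof.
apply/setP => s; rewrite !inE; case: (eqVneq s (lshift n i)) => [->|_] /=.
  by rewrite ltn_ord.
by case: eqP => [->|] //=; rewrite ltnNge leq_addr.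
Qed.

Lemma antihol_part_pair (i j : 'I_n) :
  antihol_part [set lshift n i; rshift n j]%SET = [set rshift n j]%SET.
Proof.
apply/setP => s; rewrite !inE; case: (eqVneq s (rshift n j)) => [->|_] /=.
  by rewrite orbT leq_addr.
by rewrite orbF; case: eqP => [->|] //=; rewrite leqNgt ltn_ord.
Qed.

Lemma wedge_ecov_pair (i j : 'I_n) :
  wedge (ecov (lshift n i)) (ecov (rshift n j)) =
  ebas [set lshift n i; rshift n j]%SET :> ext R n.
Proof.
rewrite -(wedge_hol_antihol _ [set lshift n i; rshift n j]%SET).
by rewrite hol_part_pair antihol_part_pair.
Qed.

Lemma type11_pair a S : has_type 1 1 a -> a S != 0 ->
  exists i j, S = [set lshift n i; rshift n j]%SET.
Proof.
move=> a11 /a11[/eqP/cards1P[s hs] /eqP/cards1P[u au]].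
have : s \in hol_part S by rewrite hs !inE.
have : u \in antihol_part S by rewrite au !inE.
rewrite !inE => /andP[_ nu] /andP[_ sn].
have SE : S = [set s; u]%SET.
  apply/setP => x; have := congr1 (fun B : {set 'I_(n + n)} => x \in B) hs.
  have := congr1 (fun B : {set 'I_(n + n)} => x \in B) au;
    rewrite /hol_part /antihol_part !inE => <- <-.
  by rewrite -andb_orr [(n <= x)%N]leqNgt orbN andbT.
case: (fintype.split_ordP s) sn SE => [i -> _ SE|i -> //].
case: (fintype.split_ordP u) nu SE => [j -> nu _|j -> _ ->];
  last by exists i, j.
by have := leq_trans (ltn_ord j) nu; rewrite ltnn.
Qed.

Lemma pair_inj (i j k l : 'I_n) :
  ([set lshift n i; rshift n j] == [set lshift n k; rshift n l])%SET =
  (i == k) && (j == l).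
Proof.
apply/eqP/andP => [e|[/eqP-> /eqP->]//]; split.
  have := congr1 (@hol_part n) e; rewrite !hol_part_pair => /finset.set1_inj.
  by move/lshift_inj=> ->.
have := congr1 (@antihol_part n) e;
  rewrite !antihol_part_pair => /finset.set1_inj.
by move/rshift_inj=> ->.
Qed.

Lemma type11E a : has_type 1 1 a ->
  a = \sum_i \sum_j
        coef11 a i j *: wedge (ecov (lshift n i)) (ecov (rshift n j)).
Proof.
move=> a11; apply/ffunP => U; rewrite ext_sumE.
under eq_bigr do rewrite ext_sumE.
have E i j : (coef11 a i j *: wedge (ecov (lshift n i)) (ecov (rshift n j))) U
    = coef11 a i j * (U == [set lshift n i; rshift n j]%SET)%:R.
  by rewrite ext_scaleE wedge_ecov_pair ffunE.
under eq_bigr do under eq_bigr do rewrite E.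
have [aU0|/(type11_pair a11)[i [j ->]]] := eqVneq (a U) 0.
  rewrite big1 // => i _; rewrite big1 // => j _; rewrite /coef11.
  by case: eqP => [<-|_]; rewrite ?aU0 ?mul0r ?mulr0.
rewrite (bigD1 i) //= (bigD1 j) //= eqxx mulr1 !big1 ?addr0 //.
  by move=> k neki; rewrite big1 // => l _;
    rewrite pair_inj eq_sym (negbTE neki) mulr0.
by move=> l nelj; rewrite pair_inj eqxx eq_sym (negbTE nelj) mulr0.
Qed.

(** This is the expansion that [pow_deriv] differentiates coefficient by coefficient. *)
Lemma wpow_type11 a m : has_type 1 1 a ->
  wpow a m = \sum_(i : {ffun 'I_m -> 'I_n}) \sum_(j : {ffun 'I_m -> 'I_n})
    (\prod_(k < m) coef11 a (i k) (j k)) *: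
    \big[@wedge R n/ebas finset.set0]_(k < m)
       wedge (ecov (lshift n (i k))) (ecov (rshift n (j k))).
Proof.
move=> /type11E aE; rewrite wpow_bigE {1}aE wedge_prod_sum.
apply: eq_bigr => i _; rewrite wedge_prod_sum; apply: eq_bigr => j _.
exact: wedge_prodZ.
Qed.

Lemma antidegree_wpow a m : antidegree 0 1 a -> antidegree 0 m (wpow a m).
Proof.
move=> a1; elim: m => [|m IHm].
  have {2}-> : 0%N = #|antihol_part (finset.set0 : {set 'I_(n + n)})|.
    by apply/esym/eq_card0 => s; rewrite !inE.
  exact: antidegree_ebas.
exact: (@antidegree_wedge R n 0 1 0 m).
Qed.

Lemma is_ederive_eq0 t (f : R -> ext R n) l S : is_ederive t f l ->
  (\forall r \near t, f r S = 0) -> l S = 0.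
Proof.
move=> fl f0; rewrite -(is_cderive_val (fl S)); apply: is_cderive_val.
by apply: is_cderive_near (is_cderive_cst t 1 0); apply: filterS f0 => r ->.
Qed.

(** The condition says that certain coefficients vanish, and a coefficient that is zero for all
    times near [t] has derivative zero. *)
Lemma antidegree_deriv d q t (f : R -> ext R n) l : is_ederive t f l ->
  (\forall r \near t, antidegree d q (f r)) -> antidegree d q l.
Proof.
move=> fl fd S; have [//|neq] := eqVneq (#|antihol_part S| + d)%N q.
case/eqP; apply: (is_ederive_eq0 fl); apply: filterS fd => r fr.
by apply: contraNeq neq => /fr->.
Qed.

Lemma has_type_deriv p q t (f : R -> ext R n) l : is_ederive t f l ->
  (\forall r \near t, has_type p q (f r)) -> has_type p q l.
Proof.
move=> fl fd S lS.
have [/andP[/eqP-> /eqP->]//|neq] :=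
  boolP ((#|hol_part S| == p) && (#|antihol_part S| == q)).
case/eqP: lS; apply: (is_ederive_eq0 fl); apply: filterS fd => r fr.
by apply: contraNeq neq => /fr[-> ->]; rewrite !eqxx.
Qed.

Lemma ederivable_wpow t (w : R -> ext R n) l m : is_ederive t w l ->
  exists p, is_ederive t (fun r => wpow (w r) m) p.
Proof.
move=> wl; elim: m => [|m [p IHm]]; first by exists 0; apply: is_ederive_cst.
by eexists; exact: is_ederive_wedge wl IHm.
Qed.

Lemma csmooth_wpow (V : normedModType R) (D : set V) (w : V -> ext R n) m S :
  open D -> (forall U, csmooth D (fun x => w x U)) ->
  csmooth D (fun x => wpow (w x) m S).
Proof.
move=> oD wD; elim: m S => [|m IHm] S; first exact: csmooth_cst.
under eq_fun do rewrite /= ffunE.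
apply: csmooth_sum => // U _; apply: csmoothM => //; apply: csmoothM => //.
exact: csmooth_cst.
Qed.

Section Variation.
Variables (t : R) (n_gt0 : (0 < n)%N).
Variables (f : R -> 'I_n -> ext R n) (l : 'I_n -> ext R n) (w b : R -> ext R n).
Hypothesis fl : forall i, is_ederive t (f^~ i) (l i).
Hypothesis ft : forall i, f t i = 0.
Hypothesis f01 : \forall r \near t, forall i, has_type 0 1 (f r i).
Hypothesis w11 : \forall r \near t, has_type 1 1 (w r).
Hypothesis bE : \forall r \near t, b r = extmap (f r) (w r).
Hypothesis db : exists L, is_ederive t b L.

Lemma variation_type01 i : has_type 0 1 (l i).
Proof. by apply: has_type_deriv (fl i) _; apply: filterS f01. Qed.

Lemma variation_degree1 i : has_degree 1 (l i).
Proof. by move=> S /(has_type_degree (@variation_type01 i)). Qed.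

Lemma variation_at0 : b t = w t.
Proof.
rewrite (nbhs_singleton bE) [RHS]ext_basis; apply: eq_bigr => S _.
by rewrite -(extbas_at0 S ft).
Qed.

Lemma ederivable_coef : exists p, is_ederive t w p.
Proof.
apply: (@ederivable_solve R n t (fun r => extbas (f r)) w b) => //.
- move=> S; eexists; apply: (is_ederive_extbas S n_gt0 fl ft) => i.
  exact: variation_degree1.
- by move=> S; exact: extbas_at0.
Qed.

Lemma variation_deriv p : is_ederive t w p ->
  exists2 q, antidegree 1 1 q & is_ederive t b (p + contr l (w t) + q).
Proof.
move=> wp.
(* The conjugate contraction of [w t], written on basis elements: it trades the antiholomorphic
   covector for a holomorphic one. *)
exists (\sum_S w t S *: wedge (ebas (hol_part S))
  (contr_conj l (ebas (antihol_part S)))).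
  apply: antidegree_sum => S _.
  have [->|/(nbhs_singleton w11)[_ aS]] := eqVneq (w t S) 0.
    by rewrite scale0r; exact: antidegree0.
  apply: antidegreeZ; apply: (@antidegree_wedge R n 0 0 1 1).
    have {2}-> : 0%N = #|antihol_part (hol_part S)|;
      last exact: antidegree_ebas.
    apply/esym/eq_card0 => s; rewrite !inE [(n <= s)%N]leqNgt.
    by case: (s < n)%N; rewrite ?andbF.
  apply: contr_conj_antidegree; first exact: variation_type01.
  have -> : 1%N = #|antihol_part (antihol_part S)|; last exact: antidegree_ebas.
  by rewrite -[LHS]aS; apply: eq_card => s; rewrite !inE -andbA andbb.
apply: (@is_ederive_near _ _ _ (fun r => \sum_S w r S *: extbas (f r) S)).
  by apply: filterS bE => r ->.
apply: is_ederive_eq.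
  apply: is_ederive_sum => S _; apply: is_ederiveZ; first exact: wp.
  apply: (is_ederive_extbas S n_gt0 fl ft) => i.
  exact: variation_degree1.
have -> : contr l (w t) = \sum_S w t S *: contr l (ebas S).
  by rewrite {1}[w t]ext_basis contr_sum; apply: eq_bigr => S _; rewrite contrZ.
have {2}-> : p = \sum_S p S *: ebas S by exact: ext_basis.
rewrite -!big_split; apply: eq_bigr => S _ /=.
rewrite (extbas_at0 S ft) [w t S *: (_ + _)]scalerDr.
exact: addrA.
Qed.

Lemma variation_wpow m p : is_ederive t (fun r => wpow (w r) m) p ->
  exists2 q, antidegree 1 m q &
    is_ederive t (fun r => wpow (b r) m) (p + contr l (wpow (w t) m) + q).
Proof.
have [w' dw] := ederivable_coef.
have [q1 q1d db'] := variation_deriv dw.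
elim: m p => [|m IHm] p dp.
  (* No basis element meets [antidegree 1 0], in accordance with the zeroth power being constant. *)
  exists 0; first exact: antidegree0.
  rewrite (is_ederive_unique dp (is_ederive_cst _ _)).
  rewrite addr0 add0r /= [contr _ _]big1; first exact: is_ederive_cst.
  by move=> i _; rewrite interior_ebas0 ?inE // wedge0r.
have [pm dpm] := ederivable_wpow m dw.
have [q qd dq] := IHm _ dpm.
(* The product-rule terms that lost an antiholomorphic covector, either in the new factor or in the
   previous power. *)
exists (wedge q1 (wpow (w t) m) + wedge (w t) q).
  have wt1 := has_type_antidegree (nbhs_singleton w11).
  apply: antidegreeD.
    exact: (@antidegree_wedge R n 1 1 0 m _ _ q1d (antidegree_wpow wt1)).
  exact: (@antidegree_wedge R n 0 1 1 m).
apply: is_ederive_eq (is_ederive_wedge db' dq) _.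
rewrite -(is_ederive_unique (is_ederive_wedge dw dpm) dp).
rewrite variation_at0 [contr _ (wpow _ m.+1)]contr_wedge;
  last exact: variation_degree1.
rewrite !wedgeDl !wedgeDr.
set x1 := wedge w' _; set x2 := wedge _ _; set x3 := wedge _ _.
set y1 := wedge _ _; set y2 := wedge _ _; set y3 := wedge _ _.
by rewrite addrACA [x1 + x2 + (y1 + y2)]addrACA.
Qed.

End Variation.

End Powers.

(** * Separating the types *)

Lemma open_time_interval (R : realType) (eps : R) : open (time_interval eps).
Proof.
rewrite (_ : time_interval eps = [set` `]- eps, eps[]);
  first exact: interval_open.
by apply/seteqP; split=> t; rewrite /= in_itv.
Qed.

Lemma open_setX (T1 T2 : topologicalType) (A : set T1) (B : set T2) :
  open A -> open B -> open (A `*` B).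
Proof.
move=> oA oB; rewrite openE => -[x y] [/= Ax By].
by exists (A, B) => //; split; apply: open_nbhs_nbhs.
Qed.

Lemma atlas_smooth_charts (R : realType) (T : topologicalType)
    (V : normedModType R) (A : set (chart T V)) c :
  smooth_atlas A -> A c -> smooth_charts A c.
Proof.
move=> [Ac _ At] cA; split; first exact: Ac.
by move=> c' c'A; split; apply: At.
Qed.

Section Near.
Variables (R : realType) (n : nat).
Local Notation E := 'rV[R]_(n + n).

Lemma wirtinger_near s (f g : E -> R[i]) y : (\forall z \near y, f z = g z) ->
  wirtinger s f y = wirtinger s g y.
Proof.
move=> fg; have cfg v : cderive f v y = cderive g v y.
  by rewrite /cderive; congr Complex; apply: near_eq_derive;
    apply: filterS fg => z ->.
by rewrite /wirtinger; case: (fintype.split s) => i; rewrite !cfg.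
Qed.

Lemma wirtinger0 s y : wirtinger s (fun _ : E => 0 : R[i]) y = 0.
Proof.
have c0 v : cderive (fun _ : E => 0 : R[i]) v y = 0.
  exact: is_cderive_val (is_cderive_cst y v 0).
by rewrite /wirtinger; case: (fintype.split s) => i;
  rewrite !c0 mulr0 ?subr0 ?addr0 mulr0.
Qed.

Lemma card_antihol_setD1_lshift (U : {set 'I_(n + n)}) i :
  #|antihol_part (U :\ lshift n i)%SET| = #|antihol_part U|.
Proof.
apply: eq_card => s; rewrite !inE; case: (eqVneq s (lshift n i)) => [->|] //=.
by rewrite [(n <= i)%N]leqNgt ltn_ord andbF.
Qed.

Lemma card_antihol_setD1_rshift (U : {set 'I_(n + n)}) i : rshift n i \in U ->
  #|antihol_part U| = #|antihol_part (U :\ rshift n i)%SET|.+1.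
Proof.
move=> iU; rewrite (cardsD1 (rshift n i)) inE iU /= leq_addr add1n; congr _.+1.
by apply: eq_card => s; rewrite !inE andbA.
Qed.

(** By degree, each coefficient of [tot] that matters agrees near [y] with one of [c] or of [p], so
    its derivatives do too; no derivative of a sum has to be split. *)
Lemma del_delbar_antidegree m (tot p c q : E -> ext R n) y :
  (\forall z \near y, tot z = p z + c z + q z) ->
  (\forall z \near y, antidegree 0 m (p z)) ->
  (\forall z \near y, antidegree 0 m.+1 (c z)) ->
  (\forall z \near y, antidegree 1 m (q z)) ->
  extd tot y = 0 -> del c y = - delbar p y.
Proof.
move=> totE pm cm qm dtot.
have vanish d k S (a : E -> ext R n) :
    (\forall z \near y, antidegree d k (a z)) ->
    (#|antihol_part S| + d)%N != k -> \forall z \near y, a z S = 0.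
  move=> ad Sk; apply: filterS ad => z az.
  by apply: contraNeq Sk => /az->.
apply/ffunP => U; rewrite ext_oppE; apply: (etrans (delE c y U)).
apply: (etrans _ (congr1 -%R (esym (delbarE p y U)))).
(* In any other degree both sides involve only coefficients that vanish near [y]. *)
have [Um|Um] := eqVneq #|antihol_part U| m.+1; last first.
  have wvanish s S (a : E -> ext R n) : (\forall z \near y, a z S = 0) ->
      wirtinger s (fun z => a z S) y = 0.
    by move=> a0; rewrite -[RHS](wirtinger0 s y); apply: wirtinger_near.
  rewrite [LHS]big1 ?[X in - X]big1 ?oppr0 // => i _; case: ifP => // iU.
    apply/eqP; rewrite mulf_eq0; apply/orP; right; apply/eqP.
    apply: wvanish; apply: (vanish _ _ _ _ pm); rewrite addn0.
    by apply: contra_neq Um => <-; apply: card_antihol_setD1_rshift.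
  apply/eqP; rewrite mulf_eq0; apply/orP; right; apply/eqP.
  by apply: wvanish; apply: (vanish _ _ _ _ cm);
    rewrite addn0 card_antihol_setD1_lshift.
apply/eqP; rewrite -addr_eq0; apply/eqP.
transitivity (extd tot y U); last by rewrite dtot ffunE.
apply: (etrans _ (esym (extd_coefE tot y U))).
apply: (congr2 +%R).
  (* Removing a holomorphic covector keeps the antiholomorphic degree m + 1, which only [c] has. *)
  apply: eq_bigr => i _.
  case iU: (lshift n i \in U) => [|//].
  apply: congr1; apply: wirtinger_near.
  set S := (U :\ _)%SET; have Sm : #|antihol_part S| = m.+1.
    by rewrite card_antihol_setD1_lshift.
  have p0 := vanish 0%N m S p pm; have q0 := vanish 1%N m S q qm.
  apply: filterS3 totE (p0 _) (q0 _) => [z ->||].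
  - by move=> pz qz; rewrite !ext_addE pz qz add0r addr0.
  - by rewrite addn0 Sm gtn_eqF.
  - by rewrite addn1 Sm gtn_eqF.
(* Removing an antiholomorphic covector leaves degree m, which only [p] has. *)
apply: eq_bigr => i _.
case iU: (rshift n i \in U) => [|//].
apply: congr1; apply: wirtinger_near.
set S := (U :\ _)%SET; have Sm : #|antihol_part S| = m.
  by have := card_antihol_setD1_rshift iU; rewrite Um => -[].
have c0 := vanish 0%N m.+1 S c cm; have q0 := vanish 1%N m S q qm.
apply: filterS3 totE (c0 _) (q0 _) => [z ->||].
- by move=> cz qz; rewrite !ext_addE cz qz !addr0.
- by rewrite addn0 Sm ltn_eqF.
- by rewrite addn1 Sm gtn_eqF.
Qed.

End Near.

(** [cderive1] has a value in any case; it is the derivability of [w] that makes [pow_deriv] the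
    genuine derivative of the power. *)
Lemma pow_deriv_is_ederive (R : realType) (n : nat) (T : topologicalType) m
    (w : R -> diff_form R n T) c z t l :
  (\forall r \near t, has_type 1 1 (w r c z)) ->
  is_ederive t (fun r => w r c z) l ->
  is_ederive t (fun r => wpow (w r c z) m) (pow_deriv m w t c z).
Proof.
move=> w11 wl.
pose W r :=
  \sum_(i : {ffun 'I_m -> 'I_n}) \sum_(j : {ffun 'I_m -> 'I_n})
    (\prod_(k < m) coef11 (w r c z) (i k) (j k)) *:
    \big[@wedge R n/ebas finset.set0]_(k < m)
       wedge (ecov (lshift n (i k))) (ecov (rshift n (j k))).
apply: (@is_ederive_near _ _ _ W).
  by apply: filterS w11 => r wr; rewrite (wpow_type11 m wr).
apply: is_ederive_sum => i _; apply: is_ederive_sum => j _.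
apply: is_ederive_eq.
  apply: is_ederiveZ; last exact: is_ederive_cst.
  apply: cderivableP; apply: cderivable_prod => k _.
  exact: is_cderive_derivable (wl _).
by rewrite scaler0 addr0 cderive1E.
Qed.

Theorem theorem1p1 (R : realType) (n : nat) (n_gt0 : (0 < n)%N)
    (* (M, J), compact, with a balanced metric g of fundamental form om *)
    (T : topologicalType) (A : set (chart T 'rV[R]_(n + n)))
    (M_complex : complex_manifold A) (M_compact : compact [set: T])
    (g : metric_tensor R n T) (om : diff_form R n T)
    (g_hermitian : hermitian_metric A A g)
    (om_fundamental : fundamental_form A A g om)
    (om_balanced : balanced A om)
    (* the family M_t, parametrized by phi *)
    (eps : R) (eps_gt0 : 0 < eps)
    (N : topologicalType) (AN : set (chart N 'rV[R]_(n + n).+1))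
    (proj : N -> R) (triv : T * R -> N) (ret : N -> T)
    (Mt : R -> set (chart T 'rV[R]_(n + n)))
    (Mt_family : differentiable_family eps A AN proj triv ret Mt)
    (phi : R -> vform R n T)
    (phi_parametrizes : parametrizes eps A Mt phi)
    (phi_extension : forall t, time_interval eps t ->
       forall p q, extension_isomorphism A (Mt t) (phi t) p q)
    (* the metrics omt t = omega_t and the (1,1)-forms wt t = omega(t) on M *)
    (omt wt : R -> diff_form R n T)
    (omt_hermitian : smooth_hermitian_family eps A Mt omt)
    (wt_type : forall t, time_interval eps t -> form_of_type A A 1 1 (wt t))
    (omt_extension : forall t, time_interval eps t ->
       is_extension A (phi t) (wt t) (omt t))
    (omt_0 : form_eq A (omt 0) om)
    (omt_balanced : forall t, time_interval eps t -> balanced A (omt t)) :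
  forall c, A c -> forall y, cimg c y ->
    del (fun z => contr (fun i => vform_deriv phi 0 c i z)
                        (wpow (om c z) n.-1)) y
    = - delbar (fun z => pow_deriv n.-1 wt 0 c z) y.
Proof.
have [_ _ [Asmooth _]] := M_complex.
move=> c cA y yc.
have cS : smooth_charts A c by exact: atlas_smooth_charts.
have oU : open (cimg c) by have [/(_ c cA)/chart_open_img] := Asmooth.
have oI : open (time_interval eps) := @open_time_interval R eps.
have I0 : time_interval eps 0 by rewrite /time_interval /= oppr_lt0 eps_gt0.
have nI : \forall r \near (0 : R), time_interval eps r by exact: open_nbhs_nbhs.
have nU : \forall z \near y, cimg c z by exact: open_nbhs_nbhs.
have oD : open (cimg c `*` time_interval eps) by exact: open_setX.
set m := n.-1.
have omt_smooth S : csmooth (cimg c `*` time_interval eps)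
    (fun p => omt p.2 c p.1 S) by exact: (herm_smooth omt_hermitian).
have pow_smooth S : csmooth (cimg c `*` time_interval eps)
    (fun p => wpow (omt p.2 c p.1) m S) by exact: csmooth_wpow.
(* The derivative at 0 of omega_t^m in the fixed chart, closed because omega_t^m is closed for every
   t. *)
pose tot z : ext R n := [ffun S => cderive1 (fun r => wpow (omt r c z) m S) 0].
have dtot : extd tot y = 0.
  apply: (extd_time_deriv (al := fun r z => wpow (omt r c z) m)
            oD _ pow_smooth oI I0).
    by [].
  by move=> r Ir; exact: (omt_balanced r Ir c cS y yc).
pose l z i := vform_deriv phi 0 c i z.
have fl z i : cimg c z -> is_ederive 0 (fun r => phi r c i z) (l z i).
  move=> zc S; rewrite ffunE cderive1E; apply: cderivableP.
  by apply: (csmooth_time_derivable _ (par_smooth phi_parametrizes cA i S)).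
have ft z i : cimg c z -> phi 0 c i z = 0 by exact: (par_0 phi_parametrizes cA).
have f01 z : cimg c z ->
    \forall r \near (0 : R), forall i, has_type 0 1 (phi r c i z).
  move=> zc; apply: filterS nI => r Ir i.
  by have [_ /(_ c cA i z zc)] := par_vform phi_parametrizes Ir.
have w11 z : cimg c z -> \forall r \near (0 : R), has_type 1 1 (wt r c z).
  by move=> zc; apply: filterS nI => r Ir;
    have [_ /(_ c cA z zc)] := wt_type r Ir.
have bE z : cimg c z -> \forall r \near (0 : R),
    omt r c z = extmap (fun i => phi r c i z) (wt r c z).
  by move=> zc; apply: filterS nI => r Ir;
    exact: (omt_extension r Ir c cA z zc).
have db z : cimg c z -> exists L, is_ederive 0 (fun r => omt r c z) L.
  move=> zc; exists [ffun S => cderive (fun r => omt r c z S) 1 0] => S.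
  rewrite ffunE; apply: cderivableP.
  by apply: (csmooth_time_derivable _ (omt_smooth S)).
have key z : cimg c z -> exists2 q, antidegree 1 m q &
   [/\ tot z = pow_deriv m wt 0 c z + contr (l z) (wpow (om c z) m) + q,
       antidegree 0 m (pow_deriv m wt 0 c z) &
       antidegree 0 m.+1 (contr (l z) (wpow (om c z) m))].
  move=> zc.
  have [w' dw] := ederivable_coef n_gt0 (fl z ^~ zc) (ft z ^~ zc) (f01 z zc)
    (bE z zc) (db z zc).
  have dp := pow_deriv_is_ederive m (w11 z zc) dw.
  have [q qd dq] := variation_wpow n_gt0 (fl z ^~ zc) (ft z ^~ zc) (f01 z zc)
    (w11 z zc) (bE z zc) (db z zc) dp.
  have w0 : wt 0 c z = om c z.
    rewrite -(omt_0 c cS z zc).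
    by rewrite -(variation_at0 (ft z ^~ zc) (bE z zc)).
  have wt1 := has_type_antidegree (nbhs_singleton (w11 z zc)).
  exists q => //; split.
  - have dtz : is_ederive 0 (fun r => wpow (omt r c z) m) (tot z).
      move=> S; rewrite ffunE cderive1E; apply: cderivableP.
      exact: is_cderive_derivable (dq S).
    by rewrite -w0; exact: is_ederive_unique dtz dq.
  - apply: (antidegree_deriv dp); apply: filterS (w11 z zc) => r wr.
    exact: antidegree_wpow (has_type_antidegree wr).
  rewrite -w0; apply: contr_antidegree; last exact: antidegree_wpow.
  exact: (variation_type01 (fl z ^~ zc) (f01 z zc)).
(* [key] yields a remainder at each point separately; defining it by subtraction gives a single form
   that agrees with all of them, without any choice. *)
pose q z := tot z - (pow_deriv m wt 0 c z + contr (l z) (wpow (om c z) m)).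
apply: (@del_delbar_antidegree _ _ m tot _ _ q) => //.
- by apply: filterS nU => z _; rewrite /q addrC subrK.
- by apply: filterS nU => z /key[? _ []].
- by apply: filterS nU => z /key[? _ []].
by apply: filterS nU => z /key[q' q'd [e _ _]];
  rewrite /q e [_ + q']addrC addrK.
Qed.
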